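(* Fix a sign (upper: positive cosmological constant, lower: negative cosmological constant). Consider the metric obtained from the Kerr-Newman-(anti-)de Sitter metric by letting the mass and charge parameters be functions $m=m(r)$ and $q=q(r)$, where $m(r)\equiv m_1$ and $q(r)\equiv q_1$ for $r\le r_1$, and $m(r)\equiv m_2>m_1$ and $q(r)\equiv q_2$ for $r\ge r_2>r_1$. Assume that $m(r)$ is at least $C^1$ (so that $m'(r_1)=m'(r_2)=0$), that $q'(r_1)=q'(r_2)=0$, that $r_1$ is larger than the event horizon radius of the solution with parameters $m_1,q_1$, that (in the de Sitter case) $r_2$ is smaller than the cosmological horizon radius of the solution with parameters $m_2,q_2$, and that $\Delta_r(r)>0$ for $r_1\le r\le r_2$. Let $T^{\mu\nu}+T^{\mu\nu}_{\mathrm{EM}}=\frac{1}{8\pi}(G^{\mu\nu}+\Lambda g^{\mu\nu})$ be the total energy-momentum tensor determined by the Einstein equations, where $T^{\mu\nu}_{\mathrm{EM}}$ is the energy-momentum tensor of the electromagnetic field in the spacetime with varying parameters $m(r),q(r)$. For $i=1,2$ let $T^{\mu\nu}_{\mathrm{EM},i}$ be the energy-momentum tensor of the electromagnetic field in the Kerr-Newman-(anti-)de Sitter spacetime with constant mass parameter $m_i$ and charge parameter $q_i$ (and the same $a$). Let $S$ be a spacelike hypersurface extending from $r=r_1$ to $r=r_2$, chosen to be a hypersurface of constant $t$, and let $$K=\frac{\partial}{\partial t}\pm\frac{a}{l^2}\frac{\partial}{\partial\varphi},\qquad Y=\frac{\partial}{\partial\varphi}.$$ Then $$\int_S \big(T^{\mu\nu}+T_{\mathrm{EM}}^{\mu\nu}\big)K_\mu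 N_\nu\,dV_3+\int_{r>r_2}T_{\mathrm{EM},2}^{\mu\nu}K_\nu N_\mu\,dV_3-\int_{r>r_1}T_{\mathrm{EM},1}^{\mu\nu}K_\nu N_\mu\,dV_3=\Delta M$$ and $$-\int_S \big(T^{\mu\nu}+T_{\mathrm{EM}}^{\mu\nu}\big)Y_\mu N_\nu\,dV_3-\int_{r>r_2}T_{\mathrm{EM},2}^{\mu\nu}Y_\nu N_\mu\,dV_3+\int_{r>r_1}T_{\mathrm{EM},1}^{\mu\nu}Y_\nu N_\mu\,dV_3=\Delta J,$$ where $\Delta M=M_2-M_1$, $\Delta J=J_2-J_1$, and $M_i=m_i/\Xi^2$, $J_i=a\,m_i/\Xi^2$ are the physical masses and angular momenta.
   Context: Units $c=G=1$; signature $(-,+,+,+)$. Upper signs refer to a positive and lower signs to a negative cosmological constant $\Lambda=\pm3/l^2$. The Kerr-Newman-(anti-)de Sitter metric with mass, charge and spin parameters $m,q,a$ is, in Boyer-Lindquist coordinates, $$ds^2=-\frac{\Delta_r}{\rho^2}\Big(dt-\frac{a\sin^2\theta}{\Xi}d\varphi\Big)^2+\frac{\rho^2}{\Delta_r}dr^2+\frac{\rho^2}{\Delta_\theta}d\theta^2+\frac{\Delta_\theta\sin^2\theta}{\rho^2}\Big(a\,dt-\frac{r^2+a^2}{\Xi}d\varphi\Big)^2,$$ with $\rho^2=r^2+a^2\cos^2\theta$, $\Xi=1\pm\frac{a^2}{l^2}$, $\Delta_r=(r^2+a^2)\big(1\mp\frac{r^2}{l^2}\big)-2mr+q^2$, $\Delta_\theta=1\pm\frac{a^2}{l^2}\cos^2\theta$.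 For constant $m,q$, together with the potential $A=-\frac{qr}{\rho^2}\big(dt-\frac{a\sin^2\theta}{\Xi}d\varphi\big)$, it solves the Einstein-Maxwell equations with cosmological constant $\Lambda$. In the interpolating metric $m,q$ are replaced by $m(r),q(r)$ in $\Delta_r$; $g_{\mu\nu}$ and $G^{\mu\nu}$ denote the interpolating metric and its Einstein tensor. In the integrals, $N$ is the future-pointing unit normal and $dV_3$ the volume element of the hypersurface. The integrals over $r>r_i$ are taken on hypersurfaces of constant $t$ with $r_i<r<\infty$ in the spacetime with constant parameters $m_i,q_i$. In the de Sitter case a hypersurface of constant $t$ is not spacelike beyond the cosmological horizon; since the integrated current is divergence-free, the integral over $r>r_i$ is that over an unbounded spacelike hypersurface, deformed into the union of a spacelike hypersurface of constant $t$ within the cosmological horizon and a timelike hypersurface of constant $t$ beyond it. *)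

(* Defs.v *)
(* Stdlib reals [R] with Coquelicot for derivatives and integrals; MathComp
   matrices over [R] (through the Rstruct instances) for inverse metrics and
   determinants.  Scalar formulas are in [R_scope]. *)
From Stdlib Require Import Reals.
From mathcomp Require Import all_boot all_algebra Rstruct.
From Coquelicot Require Import Coquelicot.

Set Implicit Arguments.
Unset Strict Implicit.
Unset Printing Implicit Defensive.

Local Open Scope R_scope.

(* Index range: (t, r, theta, phi) = (0, 1, 2, 3). *)
Definition coords := 'I_4 -> R.
Definition i_t : 'I_4 := @Ordinal 4 0 isT.
Definition i_r : 'I_4 := @Ordinal 4 1 isT.
Definition i_th : 'I_4 := @Ordinal 4 2 isT.
Definition i_ph : 'I_4 := @Ordinal 4 3 isT.

Definition bl_point (t r th ph : R) : coords := nth 0 [:: t; r; th; ph].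

Definition sum4 (f : 'I_4 -> R) : R := \big[Rplus/0]_(i < 4) f i.

Definition mx4 (f : 'I_4 -> 'I_4 -> R) : 'M[R]_4 := (\matrix_(i, j) f i j)%R.

Definition pderiv (mu : 'I_4) (f : coords -> R) (x : coords) : R :=
  Derive (fun s => f (fun nu => if nu == mu then s else x nu)) (x mu).

(** * Curvature of a metric [g], given by its lower components *)

Definition inv_metric (g : coords -> 'M[R]_4) (x : coords) : 'M[R]_4 :=
  invmx (g x).

Definition christoffel (g : coords -> 'M[R]_4) (la mu nu : 'I_4) (x : coords) : R :=
  / 2 * sum4 (fun s => inv_metric g x la s *
    (pderiv mu (fun y => g y s nu) x + pderiv nu (fun y => g y s mu) x
     - pderiv s (fun y => g y mu nu) x)).

(* R^rho_{sigma mu nu}; the sign makes the Ricci tensor of a round sphere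
   positive. *)
Definition riemann (g : coords -> 'M[R]_4) (rho sg mu nu : 'I_4) (x : coords) : R :=
  pderiv mu (christoffel g rho nu sg) x - pderiv nu (christoffel g rho mu sg) x
  + sum4 (fun la => christoffel g rho mu la x * christoffel g la nu sg x
                    - christoffel g rho nu la x * christoffel g la mu sg x).

Definition ricci (g : coords -> 'M[R]_4) (mu nu : 'I_4) (x : coords) : R :=
  sum4 (fun rho => riemann g rho mu rho nu x).

Definition scalar_curvature (g : coords -> 'M[R]_4) (x : coords) : R :=
  sum4 (fun mu => sum4 (fun nu => inv_metric g x mu nu * ricci g mu nu x)).

Definition einstein_down (g : coords -> 'M[R]_4) (mu nu : 'I_4) (x : coords) : R :=
  ricci g mu nu x - / 2 * scalar_curvature g x * g x mu nu.

Definition einstein (g : coords -> 'M[R]_4) (mu nu : 'I_4) (x : coords) : R :=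
  sum4 (fun al => sum4 (fun be =>
    inv_metric g x mu al * inv_metric g x nu be * einstein_down g al be x)).

(** * Electromagnetic energy-momentum tensor (Gaussian units) *)

Definition faraday (A : coords -> 'I_4 -> R) (mu nu : 'I_4) (x : coords) : R :=
  pderiv mu (fun y => A y nu) x - pderiv nu (fun y => A y mu) x.

Definition faraday_up (g : coords -> 'M[R]_4) (A : coords -> 'I_4 -> R)
    (mu nu : 'I_4) (x : coords) : R :=
  sum4 (fun al => sum4 (fun be =>
    inv_metric g x mu al * inv_metric g x nu be * faraday A al be x)).

Definition em_tensor (g : coords -> 'M[R]_4) (A : coords -> 'I_4 -> R)
    (mu nu : 'I_4) (x : coords) : R :=
  / (4 * PI) *
  (sum4 (fun al => sum4 (fun be =>
     g x al be * faraday_up g A mu al x * faraday_up g A nu be x))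
   - / 4 * inv_metric g x mu nu *
     sum4 (fun al => sum4 (fun be => faraday A al be x * faraday_up g A al be x))).

(** * Hypersurfaces of constant t *)

(* Induced metric in the coordinates (r, theta, phi). *)
Definition induced_metric (g : coords -> 'M[R]_4) (x : coords) : 'M[R]_3 :=
  row' i_t (col' i_t (g x)).

Definition spacelike_at (g : coords -> 'M[R]_4) (x : coords) : Prop :=
  forall v : 'rV[R]_3, v <> 0%R ->
    0 < mulmx (mulmx v (induced_metric g x)) (trmx v) ord0 ord0.

(* N_mu = - (dt)_mu / sqrt |g^{tt}|.  Where the hypersurface is spacelike
   (g^{tt} < 0), N^mu is the future-pointing unit normal: N^t > 0.  Where it is
   timelike (g^{tt} > 0, beyond a cosmological horizon), N_mu dV_3 is still
   - (dt)_mu sqrt |det g| dr dtheta dphi, so the flux integrand extends the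
   spacelike one by the same formula, as required by Gauss's theorem when a
   spacelike hypersurface is deformed into a hypersurface of constant t. *)
Definition unit_conormal (g : coords -> 'M[R]_4) (x : coords) (mu : 'I_4) : R :=
  if mu == i_t then - / sqrt (Rabs (inv_metric g x i_t i_t)) else 0.

Definition volume_density (g : coords -> 'M[R]_4) (x : coords) : R :=
  sqrt (Rabs (determinant (induced_metric g x))).

(* T^{mu nu} X_mu N_nu dV_3 / (dr dtheta dphi) on the hypersurface t = t0, for a
   symmetric T and a vector field X with constant components X^mu. *)
Definition flux_density (g : coords -> 'M[R]_4)
    (T : 'I_4 -> 'I_4 -> coords -> R) (X : 'I_4 -> R) (t0 r th ph : R) : R :=
  let x := bl_point t0 r th ph in
  sum4 (fun mu => sum4 (fun nu =>
    T mu nu x * sum4 (fun al => g x mu al * X al) * unit_conormal g x nu))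
  * volume_density g x.

(** * Integrals over the region r1 < r < r2 (or r > r1), 0 < theta < PI,
      0 < phi < 2 PI of a hypersurface of constant t *)

Definition angular_integral (f : R -> R -> R -> R) (r : R) : R :=
  RInt (fun th => RInt (fun ph => f r th ph) 0 (2 * PI)) 0 PI.

Definition angular_integrable (f : R -> R -> R -> R) (r : R) : Prop :=
  (forall th, 0 < th < PI -> ex_RInt (fun ph => f r th ph) 0 (2 * PI)) /\
  ex_RInt (fun th => RInt (fun ph => f r th ph) 0 (2 * PI)) 0 PI.

(* Finitely many radii are exempted: those where second derivatives of the
   parameter functions jump, or where a horizon makes the coordinates
   singular. *)
Definition is_shell_integral (f : R -> R -> R -> R) (r1 r2 v : R) : Prop :=
  (exists s : seq R, forall r, r1 < r < r2 -> ~ List.In r s -> angular_integrable f r) /\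
  is_RInt (angular_integral f) r1 r2 v.

Definition is_exterior_integral (f : R -> R -> R -> R) (r1 v : R) : Prop :=
  (exists s : seq R, forall r, r1 < r -> ~ List.In r s -> angular_integrable f r) /\
  is_RInt_gen (angular_integral f) (at_point r1) (Rbar_locally p_infty) v.

(** * Regularity of the parameter functions *)

Definition class_C1 (f : R -> R) : Prop :=
  (forall x, ex_derive f x) /\ (forall x, continuous (Derive f) x).

Definition class_C2 (f : R -> R) : Prop := class_C1 f /\ class_C1 (Derive f).

Inductive piecewise_C2 (f : R -> R) : R -> R -> Prop :=
| piecewise_C2_one (a b : R) (h : R -> R) :
    a < b -> class_C2 h -> (forall x, a <= x <= b -> f x = h x) -> piecewise_C2 f a b
| piecewise_C2_cat (a b c : R) :
    piecewise_C2 f a b -> piecewise_C2 f b c -> piecewise_C2 f a c.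

Definition C2_approximation (fn : nat -> R -> R) (f : R -> R) (r1 r2 : R) : Prop :=
  (forall n, class_C2 (fn n)) /\
  forall e, 0 < e -> exists n0 : nat, forall n : nat, (n0 <= n)%nat ->
    forall r, r1 <= r <= r2 ->
      Rabs (fn n r - f r) < e /\ Rabs (Derive (fn n) r - Derive f r) < e.

(* [v] is the integral over r1 < r < r2 of a density [F m q] which involves up to
   second derivatives of [m] and [q].  For piecewise C^2 functions this is the
   ordinary integral.  If [m] and [q] are only C^1, the Einstein tensor contains
   their second derivatives as distributions, and the integral is the limit of
   the ordinary integrals for C^2 functions converging to [m] and [q] in C^1. *)
Definition is_profile_integral (F : (R -> R) -> (R -> R) -> R -> R -> R -> R)
    (m q : R -> R) (r1 r2 v : R) : Prop :=
  (piecewise_C2 m r1 r2 -> piecewise_C2 q r1 r2 ->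
     is_shell_integral (F m q) r1 r2 v) /\
  (forall mn qn : nat -> R -> R,
     C2_approximation mn m r1 r2 -> C2_approximation qn q r1 r2 ->
     exists vn : nat -> R,
       eventually (fun n => is_shell_integral (F (mn n) (qn n)) r1 r2 (vn n)) /\
       is_lim_seq vn v).

(** * The interpolating Kerr-Newman-(anti-)de Sitter metric *)

Inductive cosmological_sign := DeSitter | AntiDeSitter.

Record background := Background {
  csign : cosmological_sign;
  ell : R;
  spin : R
}.

Definition Lambda_sign (b : background) : R :=
  match csign b with DeSitter => 1 | AntiDeSitter => -1 end.

Definition Lambda (b : background) : R := Lambda_sign b * (3 / ell b ^ 2).

Definition Xi (b : background) : R := 1 + Lambda_sign b * (spin b ^ 2 / ell b ^ 2).

Definition rho2 (b : background) (r th : R) : R := r ^ 2 + spin b ^ 2 * cos th ^ 2.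

Definition Delta_r (b : background) (m q : R -> R) (r : R) : R :=
  (r ^ 2 + spin b ^ 2) * (1 - Lambda_sign b * (r ^ 2 / ell b ^ 2)) - 2 * m r * r + q r ^ 2.

Definition Delta_th (b : background) (th : R) : R :=
  1 + Lambda_sign b * (spin b ^ 2 / ell b ^ 2) * cos th ^ 2.

Definition coord_form (i mu : 'I_4) : R := if mu == i then 1 else 0.

(* The one-forms dt - (a sin^2 theta / Xi) dphi and a dt - ((r^2 + a^2) / Xi) dphi. *)
Definition form_t (b : background) (th : R) (mu : 'I_4) : R :=
  coord_form i_t mu - spin b * sin th ^ 2 / Xi b * coord_form i_ph mu.

Definition form_ph (b : background) (r : R) (mu : 'I_4) : R :=
  spin b * coord_form i_t mu - (r ^ 2 + spin b ^ 2) / Xi b * coord_form i_ph mu.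

Definition kn_metric (b : background) (m q : R -> R) (x : coords) : 'M[R]_4 :=
  let r := x i_r in
  let th := x i_th in
  mx4 (fun mu nu =>
    - (Delta_r b m q r / rho2 b r th) * (form_t b th mu * form_t b th nu)
     + rho2 b r th / Delta_r b m q r * (coord_form i_r mu * coord_form i_r nu)
     + rho2 b r th / Delta_th b th * (coord_form i_th mu * coord_form i_th nu)
     + Delta_th b th * sin th ^ 2 / rho2 b r th
       * (form_ph b r mu * form_ph b r nu)).

Definition kn_potential (b : background) (q : R -> R) (x : coords) (mu : 'I_4) : R :=
  - (q (x i_r) * x i_r / rho2 b (x i_r) (x i_th)) * form_t b (x i_th) mu.

Definition total_tensor (b : background) (m q : R -> R) (mu nu : 'I_4) (x : coords) : R :=
  let g := kn_metric b m q in
  / (8 * PI) * (einstein g mu nu x + Lambda b * inv_metric g x mu nu).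

Definition T_EM (b : background) (m q : R -> R) (mu nu : 'I_4) (x : coords) : R :=
  em_tensor (kn_metric b m q) (kn_potential b q) mu nu x.

Definition T_matter (b : background) (m q : R -> R) (mu nu : 'I_4) (x : coords) : R :=
  total_tensor b m q mu nu x - T_EM b m q mu nu x.

Definition Kvec (b : background) (mu : 'I_4) : R :=
  coord_form i_t mu + Lambda_sign b * (spin b / ell b ^ 2) * coord_form i_ph mu.

Definition Yvec (mu : 'I_4) : R := coord_form i_ph mu.

Definition interpolating_flux (b : background) (X : 'I_4 -> R) (t0 : R)
    (m q : R -> R) : R -> R -> R -> R :=
  flux_density (kn_metric b m q)
    (fun mu nu x => T_matter b m q mu nu x + T_EM b m q mu nu x) X t0.

Definition em_flux (b : background) (X : 'I_4 -> R) (t0 mi qi : R) : R -> R -> R -> R :=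
  let m := fun _ => mi in
  let q := fun _ => qi in
  flux_density (kn_metric b m q) (T_EM b m q) X t0.

(** * Horizons of the solution with constant parameters *)

Definition is_cosmological_horizon (b : background) (mi qi rc : R) : Prop :=
  let Dr := Delta_r b (fun _ => mi) (fun _ => qi) in
  [/\ csign b = DeSitter, 0 < rc, Dr rc = 0,
      (exists r0, r0 < rc /\ forall r, r0 < r < rc -> 0 < Dr r)
    & forall r, rc < r -> Dr r < 0].

(* The outermost zero of Delta_r in the anti-de Sitter case, the outermost one
   inside the cosmological horizon in the de Sitter case. *)
Definition is_event_horizon (b : background) (mi qi rh : R) : Prop :=
  let Dr := Delta_r b (fun _ => mi) (fun _ => qi) in
  [/\ 0 < rh, Dr rh = 0
    & match csign b with
      | AntiDeSitter => forall r, rh < r -> 0 < Dr r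
      | DeSitter => exists rc,
          [/\ is_cosmological_horizon b mi qi rc, rh < rc
            & forall r, rh < r < rc -> 0 < Dr r]
      end].

(** * Physical mass and angular momentum *)

Definition phys_mass (b : background) (mi : R) : R := mi / Xi b ^ 2.

Definition phys_angmom (b : background) (mi : R) : R := spin b * mi / Xi b ^ 2.

(* Main.v *)
(* Outside rho2 = 0 and Delta_r = 0 the metric is block diagonal, with a Killing block h_AB in
   (t, phi) and a diagonal block in (r, theta), all entries depending on (r, theta) only.  With
   M_i = h^-1 d_i h, the mixed Ricci tensor of the Killing block is the divergence
   - (1/2) |g|^(-1/2) d_i (|g|^(1/2) g^ii M_i), and |g|^(1/2) g^rr = Delta_r sin theta / Xi,
   |g|^(1/2) g^thth = Delta_th sin theta / Xi.  The scalar curvature is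
   4 Lambda + 2 f'' / rho2, where f = m r - q^2 / 2, so the flux densities of the total
   energy-momentum along K and along Y are linear in f: they have the form d_r U + d_theta V
   with V = 0 on the axis.  For constant m and q the electromagnetic flux density is the same
   expression, by the Einstein-Maxwell equations.  Hence every integral is a difference of
   values of one charge(r) = int U dtheta dphi, which depends on f(r) and f'(r) only.
   At r_i the charges of the interpolating metric and of the solution with parameters m_i, q_i
   agree because m' and q' vanish there, and as r -> oo the charges tend to m_i / Xi^2 and
   - a m_i / Xi^2. *)
Require Import Defs.
From Stdlib Require Import Reals Lra Classical.
From mathcomp Require Import all_boot all_algebra Rstruct.
From Coquelicot Require Import Coquelicot.

Set Implicit Arguments.
Unset Strict Implicit.
Unset Printing Implicit Defensive.

Local Open Scope R_scope.

(** * Curvature of stationary axisymmetric block metrics *)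

(** Linearity in f reflects the Kerr-Schild form of the metric: in suitable coordinates it is the
    (anti-)de Sitter metric plus (2 f / rho2) times the square of a null one-form, and at f = 0 the
    flux vanishes because (anti-)de Sitter space solves the vacuum equations. To keep the algebra
    small, curvature is computed for an arbitrary block metric whose first derivatives are free
    symbols; only the combinations that enter the flux, namely traces and one contracted row, are
    made explicit for Kerr-Newman. Boyer-Lindquist components break down at Delta_r = 0, but the
    charge is smooth for all r > 0, so a single primitive serves on both sides of a horizon. Two
    exceptional sets remain: the radii with Delta_r = 0 and, on each sphere, the angles where g^tt =
    0 and the density takes the value 0. Both are finite and invisible to the integrals. No second
    derivative of m or q enters the charge. This is why pieces of C^2 functions glue without jump
    terms and why C^1 convergence suffices for merely C^1 profiles. *)

Lemma ord4P (P : 'I_4 -> Prop) : P i_t -> P i_r -> P i_th -> P i_ph -> forall i, P i.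
Proof.
move=> Pt Pr Pth Pph [[|[|[|[|n]]]] ltn4] //.
- by have -> : Ordinal ltn4 = i_t by exact: val_inj.
- by have -> : Ordinal ltn4 = i_r by exact: val_inj.
- by have -> : Ordinal ltn4 = i_th by exact: val_inj.
- by have -> : Ordinal ltn4 = i_ph by exact: val_inj.
Qed.

Lemma sum4E f : sum4 f = f i_t + f i_r + f i_th + f i_ph.
Proof.
rewrite /sum4 !big_ord_recl big_ord0.
have -> : ord0 = i_t by exact: val_inj.
have -> : lift i_t (ord0 : 'I_3) = i_r by exact: val_inj.
have -> : lift i_t (lift (ord0 : 'I_3) (ord0 : 'I_2)) = i_th by exact: val_inj.
have -> : lift i_t (lift (ord0 : 'I_3) (lift (ord0 : 'I_2) (ord0: 'I_1))) = i_ph by exact: val_inj.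
by rewrite Rplus_0_r !Rplus_assoc.
Qed.

Lemma mx4E f i j : mx4 f i j = f i j.
Proof. by rewrite /mx4 mxE. Qed.

Lemma mulmx4E (A B : 'M[R]_4) i j :
  (mulmx A B) i j = A i i_t * B i_t j + A i i_r * B i_r j + A i i_th * B i_th j + A i i_ph * B i_ph j.
Proof. by rewrite mxE -(sum4E (fun k => A i k * B k j)). Qed.

Section PartialDerivatives.

Variables (Om : R -> R -> Prop).
Hypothesis Om_open : forall r th, Om r th ->
  locally r (fun s => Om s th) /\ locally th (Om r).
Variables (f : coords -> R) (F : R -> R -> R).
Hypothesis fE : forall y, Om (y i_r) (y i_th) -> f y = F (y i_r) (y i_th).
Variable x : coords.
Hypothesis Omx : Om (x i_r) (x i_th).

(** Moving along t or phi never leaves [Om], so the restricted functions agree for every parameter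
    value. Along r and theta they agree only near the point, whence the openness of [Om]. *)
Lemma pderiv_t : pderiv i_t f x = 0.
Proof.
rewrite /pderiv -[RHS](Derive_const (F (x i_r) (x i_th)) (x i_t)).
by apply: Derive_ext => s; rewrite fE.
Qed.

Lemma pderiv_ph : pderiv i_ph f x = 0.
Proof.
rewrite /pderiv -[RHS](Derive_const (F (x i_r) (x i_th)) (x i_ph)).
by apply: Derive_ext => s; rewrite fE.
Qed.

Lemma pderiv_r v : is_derive (F^~ (x i_th)) (x i_r) v -> pderiv i_r f x = v.
Proof.
move=> dF; apply: is_derive_unique; apply: is_derive_ext_loc dF.
have [Om_r _] := Om_open Omx.
by apply: filter_imp Om_r => s Oms; rewrite fE.
Qed.

Lemma pderiv_th v : is_derive (F (x i_r)) (x i_th) v -> pderiv i_th f x = v.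
Proof.
move=> dF; apply: is_derive_unique; apply: is_derive_ext_loc dF.
have [_ Om_th] := Om_open Omx.
by apply: filter_imp Om_th => s Oms; rewrite fE.
Qed.

End PartialDerivatives.

(* The 1-jet at a point of the metric h_AB dx^A dx^B + grr dr^2 + ghh dtheta^2, A, B in {t, phi}:
   [mAB] and [nAB] are the entries of h^-1 d_r h and h^-1 d_theta h, [Pr], [Pt] ([Qr], [Qt]) the
   r- and theta-derivatives of (1/2) ln grr ((1/2) ln ghh). *)
Record block_jet := BlockJet {
  htt : R; htp : R; hpp : R; grr : R; ghh : R;
  mtt : R; mtp : R; mpt : R; mpp : R;
  ntt : R; ntp : R; npt : R; npp : R;
  Pr : R; Pt : R; Qr : R; Qt : R }.

Definition block_entry (a b c p q : R) (mu nu : nat) : R :=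
  match mu, nu with
  | 0%N, 0%N => a | 0%N, 3%N | 3%N, 0%N => b | 3%N, 3%N => c
  | 1%N, 1%N => p | 2%N, 2%N => q | _, _ => 0
  end.

Definition killing_mx (a b c p q : R) : 'M[R]_4 :=
  mx4 (fun mu nu => block_entry a b c p q mu nu).

Lemma invmx_block a b c p q : a * c - b * b <> 0 -> p <> 0 -> q <> 0 ->
  invmx (killing_mx a b c p q) =
  killing_mx (c / (a * c - b * b)) (- b / (a * c - b * b)) (a / (a * c - b * b)) (/ p) (/ q).
Proof.
move=> d0 p0 q0; set B := RHS.
have BA : mulmx B (killing_mx a b c p q) = 1%:M%R.
  apply/matrixP; elim/ord4P; elim/ord4P; rewrite mulmx4E !mx4E mxE /=;
  (* The entries of the identity matrix are MathComp constants; they are converted to the literals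
     [R0] and [R1] that [field] recognizes. *)
  by match goal with |- ?l = _ => (change (l = R0) || change (l = R1)) end; field.
have [_ uA] := mulmx1_unit BA.
by rewrite -[LHS]mul1mx -BA -mulmxA mulmxV // mulmx1.
Qed.

Definition block_det (j : block_jet) : R := htt j * hpp j - htp j * htp j.

(* [h M_r] and [h M_theta]: the r- and theta-derivatives of the Killing block. *)
Definition hr_tt j := htt j * mtt j + htp j * mpt j.
Definition hr_tp j := htt j * mtp j + htp j * mpp j.
Definition hr_pp j := htp j * mtp j + hpp j * mpp j.
Definition ht_tt j := htt j * ntt j + htp j * npt j.
Definition ht_tp j := htt j * ntp j + htp j * npp j.
Definition ht_pp j := htp j * ntp j + hpp j * npp j.

Definition jet_mx (j : block_jet) : 'M[R]_4 :=
  killing_mx (htt j) (htp j) (hpp j) (grr j) (ghh j).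

(** With A, B Killing indices and i in {r, theta}: Gamma^A_{Bi} is half the (A, B) entry of M_i, and
    Gamma^i_{AB} = - (h M_i)_{AB} / (2 g_ii). The other nonzero symbols are those of the diagonal
    block. *)
Definition jet_christoffel (la mu nu : nat) (j : block_jet) : R :=
  match la, mu, nu with
  | 0%N, 0%N, 1%N | 0%N, 1%N, 0%N => mtt j / 2
  | 0%N, 3%N, 1%N | 0%N, 1%N, 3%N => mtp j / 2
  | 3%N, 0%N, 1%N | 3%N, 1%N, 0%N => mpt j / 2
  | 3%N, 3%N, 1%N | 3%N, 1%N, 3%N => mpp j / 2
  | 0%N, 0%N, 2%N | 0%N, 2%N, 0%N => ntt j / 2
  | 0%N, 3%N, 2%N | 0%N, 2%N, 3%N => ntp j / 2
  | 3%N, 0%N, 2%N | 3%N, 2%N, 0%N => npt j / 2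
  | 3%N, 3%N, 2%N | 3%N, 2%N, 3%N => npp j / 2
  | 1%N, 0%N, 0%N => - (hr_tt j / (2 * grr j))
  | 1%N, 0%N, 3%N | 1%N, 3%N, 0%N => - (hr_tp j / (2 * grr j))
  | 1%N, 3%N, 3%N => - (hr_pp j / (2 * grr j))
  | 2%N, 0%N, 0%N => - (ht_tt j / (2 * ghh j))
  | 2%N, 0%N, 3%N | 2%N, 3%N, 0%N => - (ht_tp j / (2 * ghh j))
  | 2%N, 3%N, 3%N => - (ht_pp j / (2 * ghh j))
  | 1%N, 1%N, 1%N => Pr j
  | 1%N, 1%N, 2%N | 1%N, 2%N, 1%N => Pt j
  | 1%N, 2%N, 2%N => - (ghh j / grr j * Qr j)
  | 2%N, 2%N, 2%N => Qt j
  | 2%N, 1%N, 2%N | 2%N, 2%N, 1%N => Qr j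
  | 2%N, 1%N, 1%N => - (grr j / ghh j * Pt j)
  | _, _, _ => 0
  end.

(** Traces of M_r, M_theta and of their squares; tr M_i is the derivative of ln |det h|. *)
Definition tr_r j := mtt j + mpp j.
Definition tr_th j := ntt j + npp j.
Definition sq_r j := mtt j * mtt j + 2 * (mtp j * mpt j) + mpp j * mpp j.
Definition sq_th j := ntt j * ntt j + 2 * (ntp j * npt j) + npp j * npp j.

(** * Connection and curvature in terms of the jet *)

Section BlockCurvature.

Variable (Om : R -> R -> Prop).
Hypothesis Om_open : forall r th, Om r th ->
  locally r (fun s => Om s th) /\ locally th (Om r).
Variables (g : coords -> 'M[R]_4) (J : R -> R -> block_jet).
Hypothesis gE : forall y, Om (y i_r) (y i_th) -> g y = jet_mx (J (y i_r) (y i_th)).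

(** The entries of M_i are independent data of the jet, so the symmetry of h M_i has to be required:
    [hr_sym] and [ht_sym] equate its two off-diagonal entries. *)
Record regular_jet (r th : R) : Prop := {
  det_neq0 : block_det (J r th) <> 0;
  grr_neq0 : grr (J r th) <> 0;
  ghh_neq0 : ghh (J r th) <> 0;
  hr_sym : hr_tp (J r th) = htp (J r th) * mtt (J r th) + hpp (J r th) * mpt (J r th);
  ht_sym : ht_tp (J r th) = htp (J r th) * ntt (J r th) + hpp (J r th) * npt (J r th);
  d_r_htt : is_derive (fun s => htt (J s th)) r (hr_tt (J r th));
  d_r_htp : is_derive (fun s => htp (J s th)) r (hr_tp (J r th));
  d_r_hpp : is_derive (fun s => hpp (J s th)) r (hr_pp (J r th));
  d_r_grr : is_derive (fun s => grr (J s th)) r (2 * Pr (J r th) * grr (J r th));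
  d_r_ghh : is_derive (fun s => ghh (J s th)) r (2 * Qr (J r th) * ghh (J r th));
  d_th_htt : is_derive (fun s => htt (J r s)) th (ht_tt (J r th));
  d_th_htp : is_derive (fun s => htp (J r s)) th (ht_tp (J r th));
  d_th_hpp : is_derive (fun s => hpp (J r s)) th (ht_pp (J r th));
  d_th_grr : is_derive (fun s => grr (J r s)) th (2 * Pt (J r th) * grr (J r th));
  d_th_ghh : is_derive (fun s => ghh (J r s)) th (2 * Qt (J r th) * ghh (J r th)) }.

Hypothesis J_regular : forall r th, Om r th -> regular_jet r th.

Definition d_r_entry (j : block_jet) (mu nu : nat) : R :=
  block_entry (hr_tt j) (hr_tp j) (hr_pp j) (2 * Pr j * grr j) (2 * Qr j * ghh j) mu nu.
Definition d_th_entry (j : block_jet) (mu nu : nat) : R :=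
  block_entry (ht_tt j) (ht_tp j) (ht_pp j) (2 * Pt j * grr j) (2 * Qt j * ghh j) mu nu.

Lemma gEE y mu nu : Om (y i_r) (y i_th) -> g y mu nu =
  let j := J (y i_r) (y i_th) in
  block_entry (htt j) (htp j) (hpp j) (grr j) (ghh j) mu nu.
Proof. by move=> Omy; rewrite gE // mx4E. Qed.

Lemma pderiv_metric x (mu nu : 'I_4) : Om (x i_r) (x i_th) ->
  [/\ pderiv i_t (fun y => g y mu nu) x = 0,
      pderiv i_r (fun y => g y mu nu) x = d_r_entry (J (x i_r) (x i_th)) mu nu,
      pderiv i_th (fun y => g y mu nu) x = d_th_entry (J (x i_r) (x i_th)) mu nu
    & pderiv i_ph (fun y => g y mu nu) x = 0].
Proof.
move=> Omx; have Jx := J_regular Omx.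
pose F r th := block_entry (htt (J r th)) (htp (J r th)) (hpp (J r th)) (grr (J r th))
  (ghh (J r th)) mu nu.
have gE' y : Om (y i_r) (y i_th) -> g y mu nu = F (y i_r) (y i_th) by exact: gEE.
split.
- exact: (pderiv_t gE' Omx).
- apply: (pderiv_r Om_open gE' Omx); rewrite /F {F gE'}.
  elim/ord4P: mu; elim/ord4P: nu => /=; case: Jx => *; rewrite /d_r_entry /= => //;
  exact: is_derive_const.
- apply: (pderiv_th Om_open gE' Omx); rewrite /F {F gE'}.
  elim/ord4P: mu; elim/ord4P: nu => /=; case: Jx => *; rewrite /d_th_entry /= => //;
  exact: is_derive_const.
- exact: (pderiv_ph gE' Omx).
Qed.

Lemma inv_metric_block x (mu nu : 'I_4) : Om (x i_r) (x i_th) ->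
  inv_metric g x mu nu = let j := J (x i_r) (x i_th) in
  block_entry (hpp j / block_det j) (- htp j / block_det j) (htt j / block_det j)
    (/ grr j) (/ ghh j) mu nu.
Proof.
move=> Omx; have [d0 p0 q0 _ _ _ _ _ _ _ _ _ _ _ _] := J_regular Omx.
by rewrite /inv_metric gE // invmx_block // mx4E.
Qed.

Lemma christoffel_block x (la mu nu : 'I_4) : Om (x i_r) (x i_th) ->
  christoffel g la mu nu x = jet_christoffel la mu nu (J (x i_r) (x i_th)).
Proof.
move=> Omx; rewrite /christoffel sum4E !inv_metric_block //=.
have [d0 p0 q0 hrs hts _ _ _ _ _ _ _ _ _ _] := J_regular Omx.
have dg i j := @pderiv_metric x i j Omx.
move: (J _ _) d0 p0 q0 hrs hts dg; clear J_regular gE => j d0 p0 q0 hrs hts dg.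
have dgt i k : pderiv i_t (fun y => g y i k) x = 0 by case: (dg i k).
have dgr i k : pderiv i_r (fun y => g y i k) x = d_r_entry j i k by case: (dg i k).
have dgth i k : pderiv i_th (fun y => g y i k) x = d_th_entry j i k by case: (dg i k).
have dgp i k : pderiv i_ph (fun y => g y i k) x = 0 by case: (dg i k).
elim/ord4P: la; elim/ord4P: mu; elim/ord4P: nu;
  rewrite ?dgt ?dgr ?dgth ?dgp /d_r_entry /d_th_entry /=; try (by field);
  (* What remains is h^-1 (h M) = M. The phi column follows by expanding h M; the t column needs the
     off-diagonal entry in its symmetric form. *)
  move: d0 hrs hts; rewrite /block_det /hr_tt /hr_tp /hr_pp /ht_tt /ht_tp /ht_pp => d0 hrs hts;
  try (by field); rewrite ?hrs ?hts; by field.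
Qed.

Lemma pderiv_christoffel x (la mu nu : 'I_4) : Om (x i_r) (x i_th) ->
  [/\ pderiv i_t (christoffel g la mu nu) x = 0,
      (forall v, is_derive (fun s => jet_christoffel la mu nu (J s (x i_th))) (x i_r) v ->
        pderiv i_r (christoffel g la mu nu) x = v),
      (forall v, is_derive (fun s => jet_christoffel la mu nu (J (x i_r) s)) (x i_th) v ->
        pderiv i_th (christoffel g la mu nu) x = v)
    & pderiv i_ph (christoffel g la mu nu) x = 0].
Proof.
move=> Omx; have GE y := @christoffel_block y la mu nu.
pose F r th := jet_christoffel la mu nu (J r th).
have GE' y : Om (y i_r) (y i_th) -> christoffel g la mu nu y = F (y i_r) (y i_th)
  by exact: GE.
split.
- exact: (pderiv_t GE' Omx).
- exact: (pderiv_r Om_open GE' Omx).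
- exact: (pderiv_th Om_open GE' Omx).
- exact: (pderiv_ph GE' Omx).
Qed.

(** The shape of Gamma^i_{AB}; [is_derive_ratio] below has that of Gamma^r_{theta theta} and
    Gamma^theta_{rr}. Derivatives of metric coefficients enter as logarithmic derivatives, which
    keeps the denominators unchanged. *)
Lemma is_derive_lowered (f1 f2 f3 f4 p : R -> R) (d1 d2 d3 d4 l x : R) : p x <> 0 ->
  is_derive f1 x d1 -> is_derive f2 x d2 -> is_derive f3 x d3 -> is_derive f4 x d4 ->
  is_derive p x (2 * l * p x) ->
  is_derive (fun s => - ((f1 s * f2 s + f3 s * f4 s) / (2 * p s))) x
    (- ((d1 * f2 x + f1 x * d2 + d3 * f4 x + f3 x * d4
         - 2 * l * (f1 x * f2 x + f3 x * f4 x)) / (2 * p x))).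
Proof.
move=> p0 D1 D2 D3 D4 Dp; auto_derive.
- do !split; try (by eexists; eassumption); lra.
- rewrite (is_derive_unique _ _ _ D1) (is_derive_unique _ _ _ D2) (is_derive_unique _ _ _ D3)
    (is_derive_unique _ _ _ D4) (is_derive_unique _ _ _ Dp); by field.
Qed.

Lemma is_derive_ratio (p q f : R -> R) (lp lq d x : R) : q x <> 0 ->
  is_derive p x (2 * lp * p x) -> is_derive q x (2 * lq * q x) -> is_derive f x d ->
  is_derive (fun s => - (p s / q s * f s)) x
    (- (p x / q x * (2 * (lp - lq) * f x + d))).
Proof.
move=> q0 Dp Dq Df; auto_derive.
- by do !split; try (by eexists; eassumption).
- rewrite (is_derive_unique _ _ _ Dp) (is_derive_unique _ _ _ Dq) (is_derive_unique _ _ _ Df).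
  by field.
Qed.

Lemma is_derive_half (f : R -> R) (d x : R) : is_derive f x d ->
  is_derive (fun s => f s / 2) x (d / 2).
Proof.
move=> Df; auto_derive; first by eexists; eassumption.
rewrite (is_derive_unique _ _ _ Df); by field.
Qed.

Variable x : coords.
Hypothesis Omx : Om (x i_r) (x i_th).
Variables dmtt dmtp dmpt dmpp dQr dntt dntp dnpt dnpp dPt : R.
Hypotheses
  (Dmtt : is_derive (fun s => mtt (J s (x i_th))) (x i_r) dmtt)
  (Dmtp : is_derive (fun s => mtp (J s (x i_th))) (x i_r) dmtp)
  (Dmpt : is_derive (fun s => mpt (J s (x i_th))) (x i_r) dmpt)
  (Dmpp : is_derive (fun s => mpp (J s (x i_th))) (x i_r) dmpp)
  (DQr : is_derive (fun s => Qr (J s (x i_th))) (x i_r) dQr)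
  (Dntt : is_derive (fun s => ntt (J (x i_r) s)) (x i_th) dntt)
  (Dntp : is_derive (fun s => ntp (J (x i_r) s)) (x i_th) dntp)
  (Dnpt : is_derive (fun s => npt (J (x i_r) s)) (x i_th) dnpt)
  (Dnpp : is_derive (fun s => npp (J (x i_r) s)) (x i_th) dnpp)
  (DPt : is_derive (fun s => Pt (J (x i_r) s)) (x i_th) dPt).

Let j := J (x i_r) (x i_th).

(** The divergence of the overview, expanded: Qr - Pr + tr_r / 2 is the r-derivative of ln
    (|g|^(1/2) g^rr), and Pt - Qt + tr_th / 2 is the theta-derivative of ln (|g|^(1/2) g^thth). *)
Definition mixed_ricci (dm m dn n : R) : R :=
  - / 2 * (/ grr j * (dm + (Qr j - Pr j + tr_r j / 2) * m)
           + / ghh j * (dn + (Pt j - Qt j + tr_th j / 2) * n)).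

Let Rtt := mixed_ricci dmtt (mtt j) dntt (ntt j).
Let Rtp := mixed_ricci dmtp (mtp j) dntp (ntp j).
Let Rpt := mixed_ricci dmpt (mpt j) dnpt (npt j).
Let Rpp := mixed_ricci dmpp (mpp j) dnpp (npp j).

Lemma ricci_tt : ricci g i_t i_t x = htt j * Rtt + htp j * Rpt.
Proof.
have [d0 p0 q0 hrs hts Ahtt Ahtp Ahpp Agrr Aghh Bhtt Bhtp Bhpp Bgrr Bghh] := J_regular Omx.
rewrite /ricci sum4E /riemann.
have T la mu nu : pderiv i_t (christoffel g la mu nu) x = 0
  by case: (pderiv_christoffel la mu nu Omx).
have Ph la mu nu : pderiv i_ph (christoffel g la mu nu) x = 0
  by case: (pderiv_christoffel la mu nu Omx).
have [_ Hr _ _] := pderiv_christoffel i_r i_t i_t Omx.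
have [_ _ Hth _] := pderiv_christoffel i_th i_t i_t Omx.
rewrite !T !Ph.
rewrite (Hr _ (is_derive_lowered p0 Ahtt Dmtt Ahtp Dmpt Agrr)).
rewrite (Hth _ (is_derive_lowered q0 Bhtt Dntt Bhtp Dnpt Bghh)).
rewrite !sum4E !christoffel_block //= -/j.
rewrite /Rtt /Rtp /Rpt /Rpp /mixed_ricci.
rewrite /tr_r /tr_th /hr_tt /hr_tp /hr_pp /ht_tt /ht_tp /ht_pp.
by field.
Qed.

Lemma ricci_tp : ricci g i_t i_ph x = htp j * Rtt + hpp j * Rpt.
Proof.
have [d0 p0 q0 hrs hts Ahtt Ahtp Ahpp Agrr Aghh Bhtt Bhtp Bhpp Bgrr Bghh] := J_regular Omx.
rewrite /ricci sum4E /riemann.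
have T la mu nu : pderiv i_t (christoffel g la mu nu) x = 0
  by case: (pderiv_christoffel la mu nu Omx).
have Ph la mu nu : pderiv i_ph (christoffel g la mu nu) x = 0
  by case: (pderiv_christoffel la mu nu Omx).
have [_ Hr _ _] := pderiv_christoffel i_r i_ph i_t Omx.
have [_ _ Hth _] := pderiv_christoffel i_th i_ph i_t Omx.
rewrite !T !Ph.
(* The symmetric form of the off-diagonal entry is inserted on a whole neighbourhood, before
   differentiating. The result then involves only the derivatives of the t column of M, those
   contained in [Rtt] and [Rpt]. *)
have Er : locally (x i_r) (fun s => - ((htp (J s (x i_th)) * mtt (J s (x i_th))
    + hpp (J s (x i_th)) * mpt (J s (x i_th))) / (2 * grr (J s (x i_th)))) =
    jet_christoffel i_r i_ph i_t (J s (x i_th))).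
  have [Om_r _] := Om_open Omx; apply: filter_imp Om_r => s Oms /=.
  by rewrite (hr_sym (J_regular Oms)).
have Eth : locally (x i_th) (fun s => - ((htp (J (x i_r) s) * ntt (J (x i_r) s)
    + hpp (J (x i_r) s) * npt (J (x i_r) s)) / (2 * ghh (J (x i_r) s))) =
    jet_christoffel i_th i_ph i_t (J (x i_r) s)).
  have [_ Om_th] := Om_open Omx; apply: filter_imp Om_th => s Oms /=.
  by rewrite (ht_sym (J_regular Oms)).
rewrite (Hr _ (is_derive_ext_loc _ _ _ _ Er (is_derive_lowered p0 Ahtp Dmtt Ahpp Dmpt Agrr))).
rewrite (Hth _ (is_derive_ext_loc _ _ _ _ Eth (is_derive_lowered q0 Bhtp Dntt Bhpp Dnpt Bghh))).
rewrite !sum4E !christoffel_block //= -/j.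
rewrite /Rtt /Rtp /Rpt /Rpp /mixed_ricci.
have hrs' : htt j * mtp j = htp j * mtt j + hpp j * mpt j - htp j * mpp j.
  by rewrite -hrs /hr_tp -/j; ring.
have hts' : htt j * ntp j = htp j * ntt j + hpp j * npt j - htp j * npp j.
  by rewrite -hts /ht_tp -/j; ring.
rewrite /tr_r /tr_th /hr_tt /hr_tp /hr_pp /ht_tt /ht_tp /ht_pp.
by field [hrs' hts'].
Qed.

(** Computed separately from [ricci_tp]: the two express the same component through different
    columns of the mixed Ricci tensor, and each form is the one needed when an index is raised. *)
Lemma ricci_pt : ricci g i_ph i_t x = htt j * Rtp + htp j * Rpp.
Proof.
have [d0 p0 q0 hrs hts Ahtt Ahtp Ahpp Agrr Aghh Bhtt Bhtp Bhpp Bgrr Bghh] := J_regular Omx.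
rewrite /ricci sum4E /riemann.
have T la mu nu : pderiv i_t (christoffel g la mu nu) x = 0
  by case: (pderiv_christoffel la mu nu Omx).
have Ph la mu nu : pderiv i_ph (christoffel g la mu nu) x = 0
  by case: (pderiv_christoffel la mu nu Omx).
have [_ Hr _ _] := pderiv_christoffel i_r i_t i_ph Omx.
have [_ _ Hth _] := pderiv_christoffel i_th i_t i_ph Omx.
rewrite !T !Ph.
rewrite (Hr _ (is_derive_lowered p0 Ahtt Dmtp Ahtp Dmpp Agrr)).
rewrite (Hth _ (is_derive_lowered q0 Bhtt Dntp Bhtp Dnpp Bghh)).
rewrite !sum4E !christoffel_block //= -/j.
rewrite /Rtt /Rtp /Rpt /Rpp /mixed_ricci.
have hrs' : htt j * mtp j = htp j * mtt j + hpp j * mpt j - htp j * mpp j.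
  by rewrite -hrs /hr_tp -/j; ring.
have hts' : htt j * ntp j = htp j * ntt j + hpp j * npt j - htp j * npp j.
  by rewrite -hts /ht_tp -/j; ring.
rewrite /tr_r /tr_th /hr_tt /hr_tp /hr_pp /ht_tt /ht_tp /ht_pp.
by field [hrs' hts'].
Qed.

Lemma ricci_pp : ricci g i_ph i_ph x = htp j * Rtp + hpp j * Rpp.
Proof.
have [d0 p0 q0 hrs hts Ahtt Ahtp Ahpp Agrr Aghh Bhtt Bhtp Bhpp Bgrr Bghh] := J_regular Omx.
rewrite /ricci sum4E /riemann.
have T la mu nu : pderiv i_t (christoffel g la mu nu) x = 0
  by case: (pderiv_christoffel la mu nu Omx).
have Ph la mu nu : pderiv i_ph (christoffel g la mu nu) x = 0
  by case: (pderiv_christoffel la mu nu Omx).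
have [_ Hr _ _] := pderiv_christoffel i_r i_ph i_ph Omx.
have [_ _ Hth _] := pderiv_christoffel i_th i_ph i_ph Omx.
rewrite !T !Ph.
rewrite (Hr _ (is_derive_lowered p0 Ahtp Dmtp Ahpp Dmpp Agrr)).
rewrite (Hth _ (is_derive_lowered q0 Bhtp Dntp Bhpp Dnpp Bghh)).
rewrite !sum4E !christoffel_block //= -/j.
rewrite /Rtt /Rtp /Rpt /Rpp /mixed_ricci.
have hrs' : htt j * mtp j = htp j * mtt j + hpp j * mpt j - htp j * mpp j.
  by rewrite -hrs /hr_tp -/j; ring.
have hts' : htt j * ntp j = htp j * ntt j + hpp j * npt j - htp j * npp j.
  by rewrite -hts /ht_tp -/j; ring.
rewrite /tr_r /tr_th /hr_tt /hr_tp /hr_pp /ht_tt /ht_tp /ht_pp.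
by field [hrs' hts'].
Qed.

Lemma ricci_rr : ricci g i_r i_r x =
  - (grr j / ghh j) * (dPt + Pt j ^ 2 - Pt j * Qt j + Pt j * tr_th j / 2)
  - (dQr + Qr j ^ 2 - Pr j * Qr j - Pr j * tr_r j / 2)
  - (dmtt + dmpp) / 2 - sq_r j / 4.
Proof.
have [d0 p0 q0 hrs hts Ahtt Ahtp Ahpp Agrr Aghh Bhtt Bhtp Bhpp Bgrr Bghh] := J_regular Omx.
rewrite /ricci sum4E /riemann.
have T la mu nu : pderiv i_t (christoffel g la mu nu) x = 0
  by case: (pderiv_christoffel la mu nu Omx).
have Ph la mu nu : pderiv i_ph (christoffel g la mu nu) x = 0
  by case: (pderiv_christoffel la mu nu Omx).
have [_ H1 _ _] := pderiv_christoffel i_t i_t i_r Omx.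
have [_ H2 _ _] := pderiv_christoffel i_ph i_ph i_r Omx.
have [_ H3 _ _] := pderiv_christoffel i_th i_th i_r Omx.
have [_ _ H4 _] := pderiv_christoffel i_th i_r i_r Omx.
rewrite !T !Ph (H1 _ (is_derive_half Dmtt)) (H2 _ (is_derive_half Dmpp)) (H3 _ DQr).
rewrite (H4 _ (is_derive_ratio q0 Bgrr Bghh DPt)).
rewrite !sum4E !christoffel_block //= -/j.
rewrite /tr_r /tr_th /sq_r /hr_tt /hr_tp /hr_pp /ht_tt /ht_tp /ht_pp.
by field.
Qed.

Lemma ricci_thth : ricci g i_th i_th x =
  - (ghh j / grr j) * (dQr + Qr j ^ 2 - Qr j * Pr j + Qr j * tr_r j / 2)
  - (dPt + Pt j ^ 2 - Qt j * Pt j - Qt j * tr_th j / 2)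
  - (dntt + dnpp) / 2 - sq_th j / 4.
Proof.
have [d0 p0 q0 hrs hts Ahtt Ahtp Ahpp Agrr Aghh Bhtt Bhtp Bhpp Bgrr Bghh] := J_regular Omx.
rewrite /ricci sum4E /riemann.
have T la mu nu : pderiv i_t (christoffel g la mu nu) x = 0
  by case: (pderiv_christoffel la mu nu Omx).
have Ph la mu nu : pderiv i_ph (christoffel g la mu nu) x = 0
  by case: (pderiv_christoffel la mu nu Omx).
have [_ _ H1 _] := pderiv_christoffel i_t i_t i_th Omx.
have [_ _ H2 _] := pderiv_christoffel i_ph i_ph i_th Omx.
have [_ _ H3 _] := pderiv_christoffel i_r i_r i_th Omx.
have [_ H4 _ _] := pderiv_christoffel i_r i_th i_th Omx.
rewrite !T !Ph (H1 _ (is_derive_half Dntt)) (H2 _ (is_derive_half Dnpp)) (H3 _ DPt).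
rewrite (H4 _ (is_derive_ratio p0 Aghh Agrr DQr)).
rewrite !sum4E !christoffel_block //= -/j.
rewrite /tr_r /tr_th /sq_th /hr_tt /hr_tp /hr_pp /ht_tt /ht_tp /ht_pp.
by field.
Qed.

Lemma scalar_block : scalar_curvature g x = Rtt + Rpp
  - / ghh j * (2 * dPt + 2 * Pt j ^ 2 - 2 * Pt j * Qt j + (Pt j - Qt j) * tr_th j / 2
       + (dntt + dnpp) / 2 + sq_th j / 4)
  - / grr j * (2 * dQr + 2 * Qr j ^ 2 - 2 * Pr j * Qr j + (Qr j - Pr j) * tr_r j / 2
       + (dmtt + dmpp) / 2 + sq_r j / 4).
Proof.
have [d0 p0 q0 _ _ _ _ _ _ _ _ _ _ _ _] := J_regular Omx.
rewrite /scalar_curvature sum4E !sum4E !inv_metric_block //= -/j.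
rewrite ricci_tt ricci_tp ricci_pt ricci_pp ricci_rr ricci_thth.
move: d0; rewrite -/j; clearbody Rtt Rtp Rpt Rpp; rewrite /block_det => d0.
by field.
Qed.

(** Lowering X and raising the first index of G cancel, so only the t row of the mixed Ricci tensor
    survives, besides the scalar curvature. *)
Lemma einstein_flux (X : 'I_4 -> R) : X i_r = 0 -> X i_th = 0 ->
  sum4 (fun mu => einstein g mu i_t x * sum4 (fun al => g x mu al * X al)) =
  (Rtt - / 2 * scalar_curvature g x) * X i_t + Rtp * X i_ph.
Proof.
move=> Xr Xth.
have [d0 p0 q0 _ _ _ _ _ _ _ _ _ _ _ _] := J_regular Omx.
have E mu nu : einstein g mu nu x = sum4 (fun al => sum4 (fun be =>
  inv_metric g x mu al * inv_metric g x nu be * einstein_down g al be x)) by [].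
rewrite sum4E !E !sum4E !inv_metric_block // !gEE //= -/j Xr Xth.
rewrite /einstein_down !gEE //= -/j.
rewrite ricci_tt ricci_tp ricci_pt ricci_pp.
move: (scalar_curvature g x) => S.
move: d0; rewrite -/j; clearbody Rtt Rtp Rpt Rpp; rewrite /block_det => d0.
by field.
Qed.

End BlockCurvature.

(** * The Kerr-Newman-(anti-)de Sitter block metric *)

Ltac nonzero := repeat (assumption || apply: conj || apply: Rmult_integral_contrapositive_currified
  || apply: pow_nonzero || apply: Rinv_neq_0_compat || apply: Ropp_neq_0_compat);
  try assumption; try (exact I); try lra.

Lemma cos_pow2 th : cos th ^ 2 = 1 - sin th ^ 2.
Proof. have := sin2_cos2 th; rewrite /Rsqr; lra. Qed.

Lemma Derive_combination (f h : R -> R) (u v x : R) : ex_derive f x -> ex_derive h x ->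
  Derive (fun s => f s * u + h s * v) x = Derive f x * u + Derive h x * v.
Proof.
move=> xf xh; apply: is_derive_unique; auto_derive => //.
change (Derive (fun s => f s) x) with (Derive f x).
by change (Derive (fun s => h s) x) with (Derive h x); ring.
Qed.

Section KerrNewmanJet.

Variable b : background.
Hypotheses (ell_gt0 : 0 < ell b) (Xi_gt0 : 0 < Xi b).

Definition lam : R := Lambda_sign b / ell b ^ 2.
Let a := spin b.

Lemma Xi_lam : Xi b = 1 + lam * a ^ 2.
Proof. rewrite /Xi /lam /a; field; lra. Qed.

Lemma Delta_th_lam th : Delta_th b th = 1 + lam * a ^ 2 * cos th ^ 2.
Proof. rewrite /Delta_th /lam /a; field; lra. Qed.

Lemma Delta_r_lam m q r : Delta_r b m q r =
  (r ^ 2 + a ^ 2) * (1 - lam * r ^ 2) - 2 * m r * r + q r ^ 2.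
Proof. rewrite /Delta_r /lam /a; field; lra. Qed.

Lemma Delta_th_gt0 th : 0 < Delta_th b th.
Proof.
rewrite Delta_th_lam; move: Xi_gt0; rewrite Xi_lam.
have := pow2_ge_0 (sin th); have := pow2_ge_0 (cos th); have := cos_pow2 th.
set s2 := sin th ^ 2; set c2 := cos th ^ 2; move: (lam * a ^ 2) => l hc c0 s0 l0.
have [c0'|c0'] : c2 = 0 \/ 0 < c2 by lra.
  by rewrite c0'; lra.
have := Rmult_lt_0_compat _ _ c0' l0; lra.
Qed.

Lemma rho2_gt0 r th : 0 < r -> 0 < rho2 b r th.
Proof.
move=> r0; rewrite /rho2; have := pow2_ge_0 (spin b * cos th); have := pow_lt r 2 r0.
rewrite Rpow_mult_distr; lra.
Qed.

Variables (D D1 : R -> R).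

(* The Killing block is - (Delta_r / rho2) w w + (Delta_th sin^2 / rho2) e e for the one-forms
   w = [form_t], e = [form_ph]; [ut, up] and [vt, vp] are the components of the dual basis. *)
Definition kn_jet (r th : R) : block_jet :=
  let P := rho2 b r th in let T := Delta_th b th in let A := r ^ 2 + a ^ 2 in
  let X := Xi b in let s := sin th in let c := cos th in
  let ut := A / P in let up := a * X / P in
  let vt := - (a * s ^ 2 / P) in let vp := - (X / P) in
  let wt := 1 in let wp := - (a * s ^ 2 / X) in
  let et := a in let ep := - (A / X) in
  let e1 := D1 r / D r - 2 * r / P in
  let e2 := 2 * r * a * T * s ^ 2 / (D r * P) in
  let e3 := 2 * r / P in
  let T1 := - (2 * lam * a ^ 2 * s * c) in
  let k1 := - (2 * a * s * c / P) in
  let k2 := T1 / T + 2 * c / s + 2 * a ^ 2 * s * c / P in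
  let k3 := - (2 * a * c * D r / (s * T * P)) in
  {| htt := (T * s ^ 2 * a ^ 2 - D r) / P;
     htp := a * s ^ 2 * (D r - T * A) / (X * P);
     hpp := s ^ 2 * (T * A ^ 2 - D r * a ^ 2 * s ^ 2) / (X ^ 2 * P);
     grr := P / D r;
     ghh := P / T;
     mtt := ut * (e1 * wt + e2 * et) + vt * (e3 * (et - a * wt));
     mtp := ut * (e1 * wp + e2 * ep) + vt * (e3 * (ep - a * wp));
     mpt := up * (e1 * wt + e2 * et) + vp * (e3 * (et - a * wt));
     mpp := up * (e1 * wp + e2 * ep) + vp * (e3 * (ep - a * wp));
     ntt := ut * (k1 * (a * wt - et)) + vt * (k2 * et + k3 * wt);
     ntp := ut * (k1 * (a * wp - ep)) + vt * (k2 * ep + k3 * wp);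
     npt := up * (k1 * (a * wt - et)) + vp * (k2 * et + k3 * wt);
     npp := up * (k1 * (a * wp - ep)) + vp * (k2 * ep + k3 * wp);
     Pr := r / P - D1 r / (2 * D r);
     Pt := - (a ^ 2 * s * c / P);
     Qr := r / P;
     Qt := - (a ^ 2 * s * c / P) - T1 / (2 * T) |}.

Definition kn_domain (r th : R) : Prop := [/\ 0 < r, D r <> 0 & sin th <> 0].

Hypothesis DD : forall r, is_derive D r (D1 r).

Lemma kn_domain_open r th : kn_domain r th ->
  locally r (fun s => kn_domain s th) /\ locally th (kn_domain r).
Proof.
move=> [r0 D0 s0]; split.
- have cD : continuous D r by apply: ex_derive_continuous; exists (D1 r).
  have := cD _ (open_neq 0 _ D0); rewrite /filtermap => nD.
  have := open_gt 0 _ r0 => nr.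
  by apply: filter_imp (filter_and _ _ nr nD) => s [].
- have := continuous_sin th _ (open_neq 0 _ s0); rewrite /filtermap => ns.
  by apply: filter_imp ns => s.
Qed.

Lemma is_derive_rho2_r r th : is_derive (fun s => rho2 b s th) r (2 * r).
Proof. by rewrite /rho2; auto_derive => //; ring. Qed.

Lemma is_derive_rho2_th r th :
  is_derive (rho2 b r) th (- (2 * a ^ 2 * sin th * cos th)).
Proof. by rewrite /rho2; auto_derive => //; rewrite /a; ring. Qed.

Lemma is_derive_Delta_th th :
  is_derive (Delta_th b) th (- (2 * lam * a ^ 2 * sin th * cos th)).
Proof.
apply: (is_derive_ext (fun th => 1 + lam * a ^ 2 * cos th ^ 2)).
  by move=> t; rewrite Delta_th_lam.
by auto_derive => //; ring.
Qed.

(** The one-forms vary only along dphi, and dphi = - (Xi / rho2) (e - a w); so d_r e = (2 r / rho2)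
    (e - a w) and d_theta w = (2 a sin cos / rho2) (e - a w). Together with h^-1 w = - (rho2 /
    Delta_r) u and h^-1 e = rho2 / (Delta_th sin^2) v this yields the coefficients [e1], [e2], [e3],
    [k1], [k2], [k3] of [kn_jet]. *)
Lemma kn_jet_regular r th : kn_domain r th -> regular_jet kn_jet r th.
Proof.
move=> [r0 D0 s0].
have P0 := Rgt_not_eq _ _ (rho2_gt0 th r0); have T0 := Rgt_not_eq _ _ (Delta_th_gt0 th).
have X0 : Xi b <> 0 by lra.
have PA : rho2 b r th = r ^ 2 + a ^ 2 - a ^ 2 * sin th ^ 2 by rewrite /rho2 /a cos_pow2; ring.
have DP := is_derive_rho2_r r th; have DPt := is_derive_rho2_th r th.
have DT := is_derive_Delta_th th.
have eP := is_derive_unique _ _ _ DP; have ePt := is_derive_unique _ _ _ DPt.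
have eT := is_derive_unique _ _ _ DT; have eD := is_derive_unique _ _ _ (DD r).
have c2 := cos_pow2 th.
have xP : ex_derive (fun s => rho2 b s th) r by eexists; exact: DP.
have xPt : ex_derive (rho2 b r) th by eexists; exact: DPt.
have xT : ex_derive (Delta_th b) th by eexists; exact: DT.
have xD : ex_derive D r by eexists; exact: DD.
(* [rho2] stays an atom, so that denominators remain monomials. Its relation to r and theta is given
   to [field] as a rewriting rule for r^2; the same device recurs in the later computations. *)
have r2 : r ^ 2 = rho2 b r th - a ^ 2 + a ^ 2 * sin th ^ 2 by rewrite PA; ring.
split; rewrite /block_det /hr_tt /hr_tp /hr_pp /ht_tt /ht_tp /ht_pp /kn_jet;
  cbv beta iota zeta delta [htt htp hpp grr ghh mtt mtp mpt mpp ntt ntp npt npp Pr Pt Qr Qt];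
  rewrite -/a.
- have -> : (Delta_th b th * sin th ^ 2 * a ^ 2 - D r) / rho2 b r th *
  (sin th ^ 2 * (Delta_th b th * (r ^ 2 + a ^ 2) ^ 2 - D r * a ^ 2 * sin th ^ 2) /
   (Xi b ^ 2 * rho2 b r th)) -
  a * sin th ^ 2 * (D r - Delta_th b th * (r ^ 2 + a ^ 2)) / (Xi b * rho2 b r th) *
  (a * sin th ^ 2 * (D r - Delta_th b th * (r ^ 2 + a ^ 2)) / (Xi b * rho2 b r th)) =
  - (D r * Delta_th b th * (sin th / Xi b) ^ 2).
    by field [r2].
  apply: Ropp_neq_0_compat; apply: Rmult_integral_contrapositive_currified.
    exact: Rmult_integral_contrapositive_currified.
  by apply: pow_nonzero; apply: Rmult_integral_contrapositive_currified => //; apply: Rinv_neq_0_compat.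
- by apply: Rmult_integral_contrapositive_currified => //; apply: Rinv_neq_0_compat.
- by apply: Rmult_integral_contrapositive_currified => //; apply: Rinv_neq_0_compat.
all: try (by field [r2]).
all: try (by field [c2 r2]).
all: auto_derive; [by nonzero | rewrite ?eP ?ePt ?eT ?eD].
all: try (by field [c2 r2]).
Qed.

Lemma kn_jet_metric m q y : (forall r, D r = Delta_r b m q r) ->
  kn_domain (y i_r) (y i_th) ->
  kn_metric b m q y = jet_mx (kn_jet (y i_r) (y i_th)).
Proof.
move=> DE [r0 D0 _].
have P0 := Rgt_not_eq _ _ (rho2_gt0 (y i_th) r0).
have T0 := Rgt_not_eq _ _ (Delta_th_gt0 (y i_th)).
have X0 : Xi b <> 0 by lra.
apply/matrixP; elim/ord4P; elim/ord4P; rewrite !mx4E /form_t /form_ph /coord_form /=;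
  rewrite -DE -/a; by field.
Qed.

(** det h = - Delta_r Delta_th sin^2 / Xi^2 is a product of a function of r and a function of theta,
    so each logarithmic derivative sees one factor only. *)
Lemma kn_tr_r r th : kn_domain r th -> tr_r (kn_jet r th) = D1 r / D r.
Proof.
move=> [r0 D0 s0]; have P0 := Rgt_not_eq _ _ (rho2_gt0 th r0).
have T0 := Rgt_not_eq _ _ (Delta_th_gt0 th); have X0 : Xi b <> 0 by lra.
have r2 : r ^ 2 = rho2 b r th - a ^ 2 + a ^ 2 * sin th ^ 2 by rewrite /rho2 cos_pow2 /a; ring.
by rewrite /tr_r /kn_jet /=; field [r2].
Qed.

Lemma kn_tr_th r th : kn_domain r th -> tr_th (kn_jet r th) =
  - (2 * lam * a ^ 2 * sin th * cos th) / Delta_th b th + 2 * cos th / sin th.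
Proof.
move=> [r0 D0 s0]; have P0 := Rgt_not_eq _ _ (rho2_gt0 th r0).
have T0 := Rgt_not_eq _ _ (Delta_th_gt0 th); have X0 : Xi b <> 0 by lra.
have r2 : r ^ 2 = rho2 b r th - a ^ 2 + a ^ 2 * sin th ^ 2 by rewrite /rho2 cos_pow2 /a; ring.
by rewrite /tr_th /kn_jet /=; field [r2].
Qed.

Variables (r th : R).
Hypothesis dom : kn_domain r th.

Let P := rho2 b r th.
Let T := Delta_th b th.
Let s := sin th.
Let c := cos th.
Let X := Xi b.
Let A := r ^ 2 + a ^ 2.
Let T1 := - (2 * lam * a ^ 2 * s * c).
Let P0 : P <> 0.
Proof. by apply: Rgt_not_eq; apply: rho2_gt0; case: dom. Qed.
Let T0 : T <> 0.
Proof. by apply: Rgt_not_eq; apply: Delta_th_gt0. Qed.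
Let X0 : X <> 0.
Proof. by rewrite /X; lra. Qed.
Let D0 : D r <> 0.
Proof. by case: dom. Qed.
Let s0 : s <> 0.
Proof. by case: dom. Qed.
Let c2 : c ^ 2 = 1 - s ^ 2.
Proof. exact: cos_pow2. Qed.
Let r2 : r ^ 2 = P - a ^ 2 + a ^ 2 * s ^ 2.
Proof. by rewrite /P /rho2 cos_pow2 /a /s; ring. Qed.

Ltac unfold_jet := rewrite /kn_jet;
  cbv beta iota zeta delta [htt htp hpp grr ghh mtt mtp mpt mpp ntt ntp npt npp Pr Pt Qr Qt];
  rewrite -/a -/P -/T -/s -/c -/X -/A -/T1.

Lemma kn_sq_r : sq_r (kn_jet r th) =
  (D1 r / D r - 2 * r / P) ^ 2 - 8 * r ^ 2 * a ^ 2 * T * s ^ 2 / (D r * P ^ 2) + 4 * r ^ 2 / P ^ 2.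
Proof. by rewrite /sq_r; unfold_jet; rewrite /A; field [r2]. Qed.

Lemma kn_sq_th : sq_th (kn_jet r th) =
  (2 * a ^ 2 * s * c / P) ^ 2 - 8 * a ^ 2 * c ^ 2 * D r / (T * P ^ 2)
  + (T1 / T + 2 * c / s + 2 * a ^ 2 * s * c / P) ^ 2.
Proof. by rewrite /sq_th; unfold_jet; rewrite /A; field [r2]. Qed.

Variable D2 : R.
Hypothesis DD1 : is_derive D1 r D2.

Let xP : ex_derive (fun s => rho2 b s th) r.
Proof. by eexists; exact: is_derive_rho2_r. Qed.
Let xPt : ex_derive (rho2 b r) th.
Proof. by eexists; exact: is_derive_rho2_th. Qed.
Let xT : ex_derive (Delta_th b) th.
Proof. by eexists; exact: is_derive_Delta_th. Qed.
Let xD : ex_derive D r.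
Proof. by eexists; exact: DD. Qed.
Let xD1 : ex_derive D1 r.
Proof. by eexists; exact: DD1. Qed.
Let eP : Derive (fun s => rho2 b s th) r = 2 * r.
Proof. exact: is_derive_unique (is_derive_rho2_r r th). Qed.
Let ePt : Derive (rho2 b r) th = - (2 * a ^ 2 * s * c).
Proof. exact: is_derive_unique (is_derive_rho2_th r th). Qed.
Let eT : Derive (Delta_th b) th = T1.
Proof. exact: is_derive_unique (is_derive_Delta_th th). Qed.
Let eD : Derive D r = D1 r.
Proof. exact: is_derive_unique (DD r). Qed.
Let eD1 : Derive D1 r = D2.
Proof. exact: is_derive_unique DD1. Qed.

Ltac derive_jet := rewrite /kn_jet;
  cbv beta iota zeta delta [htt htp hpp grr ghh mtt mtp mpt mpp ntt ntp npt npp Pr Pt Qr Qt];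
  auto_derive; [by nonzero | ].

Lemma kn_dQr : is_derive (fun s => Qr (kn_jet s th)) r (1 / P - 2 * r ^ 2 / P ^ 2).
Proof. by derive_jet; rewrite eP -/P; field. Qed.

Lemma kn_dPt : is_derive (fun s => Pt (kn_jet r s)) th
  (- (a ^ 2 * (c ^ 2 - s ^ 2) / P + 2 * a ^ 4 * s ^ 2 * c ^ 2 / P ^ 2)).
Proof. by derive_jet; rewrite ePt -/P -/s -/c; field. Qed.

(** For single entries of M_r and M_theta existence of the derivative is enough: explicit values are
    computed only for traces and for the contracted t row. *)
Lemma kn_ex_mtt : ex_derive (fun s => mtt (kn_jet s th)) r.
Proof. by eexists; derive_jet; reflexivity. Qed.
Lemma kn_ex_mtp : ex_derive (fun s => mtp (kn_jet s th)) r.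
Proof. by eexists; derive_jet; reflexivity. Qed.
Lemma kn_ex_mpt : ex_derive (fun s => mpt (kn_jet s th)) r.
Proof. by eexists; derive_jet; reflexivity. Qed.
Lemma kn_ex_mpp : ex_derive (fun s => mpp (kn_jet s th)) r.
Proof. by eexists; derive_jet; reflexivity. Qed.
Lemma kn_ex_ntt : ex_derive (fun s => ntt (kn_jet r s)) th.
Proof. by eexists; derive_jet; reflexivity. Qed.
Lemma kn_ex_ntp : ex_derive (fun s => ntp (kn_jet r s)) th.
Proof. by eexists; derive_jet; reflexivity. Qed.
Lemma kn_ex_npt : ex_derive (fun s => npt (kn_jet r s)) th.
Proof. by eexists; derive_jet; reflexivity. Qed.
Lemma kn_ex_npp : ex_derive (fun s => npp (kn_jet r s)) th.
Proof. by eexists; derive_jet; reflexivity. Qed.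

Variables Xt Xp : R.
Let w := Xt - a * s ^ 2 / X * Xp.
Let e := a * Xt - A / X * Xp.
Let e1 := - (2 * r / X * Xp).
Let w1 := - (2 * a * s * c / X * Xp).

(* [row_r / D] and [row_th / T] are the t-components of M_r v and M_theta v for v = (Xt, Xp). *)
Definition row_r : R := A * D1 r * w / P - 2 * r * A * D r * w / P ^ 2
  + 2 * r * a * T * s ^ 2 * A * e / P ^ 2 + 2 * r * a * s ^ 2 * D r * Xp / (X * P).

(** The expanded r-derivative of [row_r], with D2 for the second derivative of Delta_r. *)
Definition d_row_r : R :=
  w * (2 * r * D1 r / P + A * D2 / P - 4 * r * A * D1 r / P ^ 2
       - 2 * (A + 2 * r ^ 2) * D r / P ^ 2 + 8 * r ^ 2 * A * D r / P ^ 3)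
  + 2 * a * T * s ^ 2 * ((A + 2 * r ^ 2) * e / P ^ 2 + r * A * e1 / P ^ 2
       - 4 * r ^ 2 * A * e / P ^ 3)
  + 2 * a * s ^ 2 * Xp / X * (D r / P + r * D1 r / P - 2 * r ^ 2 * D r / P ^ 2).

(** [B] is rho2 times the theta-derivative of Delta_th sin^2 / rho2, and [B1] is the
    theta-derivative of [B]. *)
Let B := T1 * s ^ 2 + 2 * c * s * T + 2 * a ^ 2 * s ^ 3 * c * T / P.
Let B1 := - (2 * lam * a ^ 2 * (3 * s ^ 2 * c ^ 2 - s ^ 4)) + 2 * (c ^ 2 - s ^ 2) * T
  + 2 * c * s * T1 + 2 * a ^ 2 * ((3 * s ^ 2 * c ^ 2 - s ^ 4) * T / P + s ^ 3 * c * T1 / P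
  + 2 * a ^ 2 * s ^ 4 * c ^ 2 * T / P ^ 2).

Definition row_th : R :=
  - (2 * a * s * c * T * A / (P * X) * Xp) - a * B * e / P + 2 * a ^ 2 * s * c * D r * w / P ^ 2.

Definition d_row_th : R :=
  - (2 * a / X * Xp * A * ((T1 * s * c + T * (c ^ 2 - s ^ 2)) / P
       + 2 * a ^ 2 * s ^ 2 * c ^ 2 * T / P ^ 2))
  - a * e * (B1 / P + 2 * a ^ 2 * s * c * B / P ^ 2)
  + 2 * a ^ 2 * D r * ((c ^ 2 - s ^ 2) * w / P ^ 2 + s * c * w1 / P ^ 2
       + 4 * a ^ 2 * s ^ 2 * c ^ 2 * w / P ^ 3).

Lemma kn_row_r : mtt (kn_jet r th) * Xt + mtp (kn_jet r th) * Xp = row_r / D r.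
Proof. by unfold_jet; rewrite /row_r /w /e /A; field [r2]. Qed.

Lemma kn_row_th : ntt (kn_jet r th) * Xt + ntp (kn_jet r th) * Xp = row_th / T.
Proof. by unfold_jet; rewrite /row_th /B /w /e /A; field [r2]. Qed.

Lemma kn_d_row_r : is_derive (fun s => mtt (kn_jet s th) * Xt + mtp (kn_jet s th) * Xp) r
  (d_row_r / D r - row_r * D1 r / D r ^ 2).
Proof.
derive_jet; rewrite eP eD eD1 -/P -/T -/s -/X -/a.
rewrite /row_r /d_row_r /w /e /e1 /A; by field [r2].
Qed.

Lemma kn_d_row_th : is_derive (fun s => ntt (kn_jet r s) * Xt + ntp (kn_jet r s) * Xp) th
  (d_row_th / T - row_th * T1 / T ^ 2).
Proof.
derive_jet; rewrite ePt eT -/P -/T -/s -/c -/X -/a.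
rewrite /row_th /d_row_th /B /B1 /w /e /w1 /T1 /A; by field [c2 r2].
Qed.
Variables (g : coords -> 'M[R]_4) (x : coords).
Hypotheses (xr : x i_r = r) (xth : x i_th = th).
Hypothesis gE : forall y, kn_domain (y i_r) (y i_th) -> g y = jet_mx (kn_jet (y i_r) (y i_th)).

Let domx : kn_domain (x i_r) (x i_th).
Proof. by rewrite xr xth. Qed.

(** By [scalar_block] only the traces of M_r, M_theta, of their squares and of their derivatives
    matter. The derivatives of single entries can therefore be generalized to unknowns tied by [dtr]
    and [dtth] alone. *)
Lemma kn_scalar : scalar_curvature g x =
  - (D2 - 2 + 2 * lam * a ^ 2 - 12 * lam * a ^ 2 * c ^ 2) / P.
Proof.
have DQr := kn_dQr; have DPt := kn_dPt; move: DQr DPt.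
have Dmtt := Derive_correct _ _ kn_ex_mtt; have Dmtp := Derive_correct _ _ kn_ex_mtp.
have Dmpt := Derive_correct _ _ kn_ex_mpt; have Dmpp := Derive_correct _ _ kn_ex_mpp.
have Dntt := Derive_correct _ _ kn_ex_ntt; have Dntp := Derive_correct _ _ kn_ex_ntp.
have Dnpt := Derive_correct _ _ kn_ex_npt; have Dnpp := Derive_correct _ _ kn_ex_npp.
have dtr : Derive (fun s => mtt (kn_jet s th)) r + Derive (fun s => mpp (kn_jet s th)) r
    = D2 / D r - D1 r ^ 2 / D r ^ 2.
  rewrite -Derive_plus; [|exact: kn_ex_mtt|exact: kn_ex_mpp].
  apply: is_derive_unique.
  apply: (is_derive_ext_loc (fun s => D1 s / D s)).
    have [nr _] := kn_domain_open dom.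
    by apply: filter_imp nr => t dt; rewrite -(kn_tr_r dt).
  by auto_derive; [by nonzero | rewrite eD eD1; field].
have dtth : Derive (fun s => ntt (kn_jet r s)) th + Derive (fun s => npp (kn_jet r s)) th
    = - (2 * lam * a ^ 2 * (c ^ 2 - s ^ 2)) / T - T1 ^ 2 / T ^ 2 - 2 * (s ^ 2 + c ^ 2) / s ^ 2.
  rewrite -Derive_plus; [|exact: kn_ex_ntt|exact: kn_ex_npp].
  apply: is_derive_unique.
  apply: (is_derive_ext_loc (fun s => - (2 * lam * a ^ 2 * sin s * cos s) / Delta_th b s
      + 2 * cos s / sin s)).
    have [_ nth] := kn_domain_open dom.
    by apply: filter_imp nth => t dt; rewrite -(kn_tr_th dt).
  by auto_derive; [by nonzero | rewrite eT -/s -/c -/T /T1; field].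
move: Dmtt Dmtp Dmpt Dmpp Dntt Dntp Dnpt Dnpp dtr dtth.
move: (Derive _ r) (Derive _ r) (Derive _ r) (Derive _ r) => dmpp dmpt dmtp dmtt.
move: (Derive _ th) (Derive _ th) (Derive _ th) (Derive _ th) => dnpp dnpt dntp dntt.
rewrite -xr -xth => Dmtt Dmtp Dmpt Dmpp Dntt Dntp Dnpt Dnpp dtr dtth DQr DPt.
rewrite (scalar_block kn_domain_open gE kn_jet_regular domx Dmtt Dmtp Dmpt Dmpp DQr
  Dntt Dntp Dnpt Dnpp DPt).
move: dtr dtth; rewrite xr xth => dtr dtth.
have -> : mixed_ricci kn_jet x dmtt (mtt (kn_jet r th)) dntt
    (ntt (kn_jet r th))
  + mixed_ricci kn_jet x dmpp (mpp (kn_jet r th)) dnpp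
    (npp (kn_jet r th))
  = mixed_ricci kn_jet x (dmtt + dmpp) (tr_r (kn_jet r th)) (dntt + dnpp) (tr_th (kn_jet r th)).
  by rewrite /mixed_ricci xr xth /tr_r /tr_th; ring.
rewrite /mixed_ricci xr xth dtr dtth (kn_tr_r dom) (kn_tr_th dom) kn_sq_r kn_sq_th.
unfold_jet.
have TE : T = 1 + lam * a ^ 2 - lam * a ^ 2 * s ^ 2 by rewrite /T Delta_th_lam -/c c2; ring.
(* Rewriting rule relating [lam] to the atom Delta_th. *)
have l2 : lam * a ^ 2 * s ^ 2 = 1 + lam * a ^ 2 - T by rewrite TE; ring.
rewrite /T1.
by field [c2 r2 l2].
Qed.

(** The logarithmic derivatives of |g|^(1/2) g^rr and |g|^(1/2) g^thth are D' / D and T' / T + cos /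
    sin. Their first parts cancel the terms produced by differentiating the denominators of [row_r]
    / D and [row_th] / T; the sine leaves the cotangent term. *)
Lemma kn_einstein_flux (V : 'I_4 -> R) :
  V i_t = Xt -> V i_r = 0 -> V i_th = 0 -> V i_ph = Xp ->
  sum4 (fun mu => einstein g mu i_t x * sum4 (fun al => g x mu al * V al)) =
  - (d_row_r + d_row_th + c / s * row_th) / (2 * P) - / 2 * scalar_curvature g x * Xt.
Proof.
move=> VXt Vr Vth VXp.
have Dmtt := Derive_correct _ _ kn_ex_mtt; have Dmtp := Derive_correct _ _ kn_ex_mtp.
have Dmpt := Derive_correct _ _ kn_ex_mpt; have Dmpp := Derive_correct _ _ kn_ex_mpp.
have Dntt := Derive_correct _ _ kn_ex_ntt; have Dntp := Derive_correct _ _ kn_ex_ntp.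
have Dnpt := Derive_correct _ _ kn_ex_npt; have Dnpp := Derive_correct _ _ kn_ex_npp.
have dr : Derive (fun s => mtt (kn_jet s th)) r * Xt + Derive (fun s => mtp (kn_jet s th)) r * Xp
    = d_row_r / D r - row_r * D1 r / D r ^ 2.
  rewrite -(is_derive_unique _ _ _ kn_d_row_r).
  by rewrite (Derive_combination _ _ kn_ex_mtt kn_ex_mtp).
have dth : Derive (fun s => ntt (kn_jet r s)) th * Xt + Derive (fun s => ntp (kn_jet r s)) th * Xp
    = d_row_th / T - row_th * T1 / T ^ 2.
  rewrite -(is_derive_unique _ _ _ kn_d_row_th).
  by rewrite (Derive_combination _ _ kn_ex_ntt kn_ex_ntp).
move: Dmtt Dmtp Dmpt Dmpp Dntt Dntp Dnpt Dnpp dr dth.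
move: (Derive _ r) (Derive _ r) (Derive _ r) (Derive _ r) => dmpp dmpt dmtp dmtt.
move: (Derive _ th) (Derive _ th) (Derive _ th) (Derive _ th) => dnpp dnpt dntp dntt.
rewrite -xr -xth => Dmtt Dmtp Dmpt Dmpp Dntt Dntp Dnpt Dnpp dr dth.
rewrite (einstein_flux kn_domain_open gE kn_jet_regular domx Dmtt Dmtp Dmpt Dmpp
  Dntt Dntp Dnpt Dnpp Vr Vth).
rewrite VXt VXp; move: dr dth; rewrite xr xth => dr dth.
have <- : mixed_ricci kn_jet x (dmtt * Xt + dmtp * Xp)
      (mtt (kn_jet r th) * Xt + mtp (kn_jet r th) * Xp)
      (dntt * Xt + dntp * Xp) (ntt (kn_jet r th) * Xt + ntp (kn_jet r th) * Xp)
      - / 2 * scalar_curvature g x * Xt =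
  (mixed_ricci kn_jet x dmtt (mtt (kn_jet r th)) dntt (ntt (kn_jet r th)) -
   / 2 * scalar_curvature g x) * Xt +
  mixed_ricci kn_jet x dmtp (mtp (kn_jet r th)) dntp (ntp (kn_jet r th)) * Xp.
  by rewrite /mixed_ricci; ring.
rewrite /mixed_ricci xr xth dr dth (kn_tr_r dom) (kn_tr_th dom) kn_row_r kn_row_th.
move: (scalar_curvature g x) row_r row_th d_row_r d_row_th => S Mr Mth dMr dMth.
unfold_jet; rewrite /T1; by field.
Qed.

End KerrNewmanJet.

(** * Flux densities on hypersurfaces of constant t *)

Lemma det_induced_block a b c p q (g : coords -> 'M[R]_4) x : g x = killing_mx a b c p q ->
  determinant (induced_metric g x) = p * q * c.
Proof.
move=> gx; pose d : 'rV[R]_3 := (\row_i nth 0 [:: p; q; c] i)%R.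
have -> : induced_metric g x = diag_mx d.
  apply/matrixP => i k; rewrite /induced_metric !mxE gx mx4E /=.
  case: i => [[|[|[|i]]] //= Hi]; case: k => [[|[|[|k]]] //= Hk];
  by rewrite -val_eqE /= ?mulr1n ?mulr0n.
rewrite det_diag !big_ord_recl big_ord0 !mxE /=.
by change (p * (q * (c * 1)) = p * q * c); ring.
Qed.

(* Where g^tt = 0, that is c = 0, the hypersurface is null and [volume_density] vanishes. *)
Lemma flux_density_block a b c p q (g : coords -> 'M[R]_4) (T : 'I_4 -> 'I_4 -> coords -> R)
    (V : 'I_4 -> R) (t0 r th ph vol : R) : let x := bl_point t0 r th ph in
  g x = killing_mx a b c p q -> a * c - b * b <> 0 -> p <> 0 -> q <> 0 ->
  0 <= vol -> p * q * (a * c - b * b) = - vol ^ 2 ->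
  flux_density g T V t0 r th ph = if Req_EM_T c 0 then 0 else
    - vol * sum4 (fun mu => T mu i_t x * sum4 (fun al => g x mu al * V al)).
Proof.
move=> x gx d0 p0 q0 v0 vE; rewrite /flux_density -/x /volume_density (det_induced_block gx).
have gtt : inv_metric g x i_t i_t = c / (a * c - b * b).
  by rewrite /inv_metric gx invmx_block // mx4E.
have E : p * q * c = - (vol ^ 2 * (c / (a * c - b * b))).
  transitivity (p * q * (a * c - b * b) * (c / (a * c - b * b))); first by field.
  by rewrite vE; ring.
case: Req_EM_T => c0 /=; first by rewrite c0 Rmult_0_r Rabs_R0 sqrt_0 Rmult_0_r.
have u0 : c / (a * c - b * b) <> 0.
  by apply: Rmult_integral_contrapositive_currified => //; apply: Rinv_neq_0_compat.
rewrite E Rabs_Ropp Rabs_mult Rabs_right; last by apply: Rle_ge; apply: pow2_ge_0.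
rewrite sqrt_mult; [|exact: pow2_ge_0|exact: Rabs_pos].
rewrite sqrt_pow2 // !sum4E /unit_conormal /= gtt.
have s0 : sqrt (Rabs (c / (a * c - b * b))) <> 0.
  by apply: Rgt_not_eq; apply: sqrt_lt_R0; apply: Rabs_pos_lt.
move: (sqrt _) s0 => u s0; by field.
Qed.

Lemma inv_metric_lower a b c p q (g : coords -> 'M[R]_4) (x : coords) (V : 'I_4 -> R) :
  g x = killing_mx a b c p q -> a * c - b * b <> 0 -> p <> 0 -> q <> 0 ->
  sum4 (fun mu => inv_metric g x mu i_t * sum4 (fun al => g x mu al * V al)) = V i_t.
Proof.
move=> gx d0 p0 q0; rewrite !sum4E /inv_metric gx invmx_block // !mx4E /=; by field.
Qed.

(** The arguments are F_{r t}, F_{r phi}, F_{theta t}, F_{theta phi}. F_{t phi} and F_{r theta}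
    vanish for a potential with Killing components depending on r and theta only. *)
Definition faraday_entry (u v y z : R) (mu nu : nat) : R :=
  match mu, nu with
  | 1%N, 0%N => u | 0%N, 1%N => - u | 1%N, 3%N => v | 3%N, 1%N => - v
  | 2%N, 0%N => y | 0%N, 2%N => - y | 2%N, 3%N => z | 3%N, 2%N => - z
  | _, _ => 0
  end.

Lemma em_flux_block a b c p q u v y z (g : coords -> 'M[R]_4) (A : coords -> 'I_4 -> R)
    (x : coords) (V : 'I_4 -> R) :
  g x = killing_mx a b c p q -> a * c - b * b <> 0 -> p <> 0 -> q <> 0 ->
  (forall mu nu, faraday A mu nu x = faraday_entry u v y z mu nu) ->
  V i_r = 0 -> V i_th = 0 ->
  sum4 (fun mu => em_tensor g A mu i_t x * sum4 (fun al => g x mu al * V al)) =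
  / (4 * PI) * / (a * c - b * b) *
    (((c * u - b * v) * (V i_t * u + V i_ph * v) / p
      + (c * y - b * z) * (V i_t * y + V i_ph * z) / q)
     - V i_t / 2 * ((c * u ^ 2 - 2 * b * u * v + a * v ^ 2) / p
                    + (c * y ^ 2 - 2 * b * y * z + a * z ^ 2) / q)).
Proof.
move=> gx d0 p0 q0 FE Vr Vth.
have gE mu nu : inv_metric g x mu nu = block_entry (c / (a * c - b * b))
    (- b / (a * c - b * b)) (a / (a * c - b * b)) (/ p) (/ q) mu nu.
  by rewrite /inv_metric gx invmx_block // mx4E.
have UE : forall mu nu, faraday_up g A mu nu x =
    faraday_entry (/ p * ((c * u - b * v) / (a * c - b * b))) (/ p * ((a * v - b * u) / (a * c - b * b)))
      (/ q * ((c * y - b * z) / (a * c - b * b))) (/ q * ((a * z - b * y) / (a * c - b * b))) mu nu.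
  by elim/ord4P; elim/ord4P; rewrite /faraday_up !sum4E !gE !FE /=; field.
rewrite sum4E /em_tensor !sum4E !UE !FE !gE gx !mx4E /= Vr Vth.
have PI0 := PI_neq0; by field.
Qed.

Section FluxDensity.

Variable b : background.
Hypotheses (ell_gt0 : 0 < ell b) (Xi_gt0 : 0 < Xi b).
Let a := spin b.
Let X := Xi b.
Let l := lam b.
Let kap := / (16 * PI * X ^ 2).

(* [Phi_K] and [Phi_Y] are d_r U + d_theta V written out in terms of f, f' and f'', with
   U_K = kap sin {- 2 a^2 sin^2 L f' / P + 4 r A T f / P^2 - 4 l r a^2 sin^2 f / P},
   V_K = - 4 kap a^2 sin^2 cos T f / P^2,
   U_Y = kap a sin^3 {2 A f' / P - 4 r f / P - 4 r A f / P^2}, V_Y = 4 kap a^3 sin^4 cos f / P^2. *)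
Definition Phi_K (f f1 f2 r th : R) : R :=
  let P := rho2 b r th in let T := Delta_th b th in let A := r ^ 2 + a ^ 2 in
  let L := 1 - l * r ^ 2 in let s := sin th in let c := cos th in
  kap * s * (- (2 * a ^ 2 * s ^ 2 * (L * f2 / P - 2 * l * r * f1 / P - 2 * r * L * f1 / P ^ 2))
    + 4 * T * ((A + 2 * r ^ 2) * f / P ^ 2 + r * A * f1 / P ^ 2 - 4 * r ^ 2 * A * f / P ^ 3)
    - 4 * l * a ^ 2 * s ^ 2 * (f / P + r * f1 / P - 2 * r ^ 2 * f / P ^ 2))
  - 4 * kap * a ^ 2 * f * ((2 * s * c ^ 2 - s ^ 3) * T / P ^ 2
    - 2 * l * a ^ 2 * s ^ 3 * c ^ 2 / P ^ 2 + 4 * a ^ 2 * s ^ 3 * c ^ 2 * T / P ^ 3).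

Definition Phi_Y (f f1 f2 r th : R) : R :=
  let P := rho2 b r th in let A := r ^ 2 + a ^ 2 in
  let s := sin th in let c := cos th in
  kap * a * s ^ 3 * (2 * A * f2 / P - 8 * r * A * f1 / P ^ 2 - 4 * f / P
    + 8 * r ^ 2 * f / P ^ 2 - 4 * (A + 2 * r ^ 2) * f / P ^ 2 + 16 * r ^ 2 * A * f / P ^ 3)
  + 4 * kap * a ^ 3 * f * ((4 * s ^ 3 * c ^ 2 - s ^ 5) / P ^ 2 + 4 * a ^ 2 * s ^ 5 * c ^ 2 / P ^ 3).

Section Curvature.

Variables (D D1 : R -> R) (D2 r th f f1 f2 : R).
Hypotheses (DD : forall r, is_derive D r (D1 r)) (DD1 : is_derive D1 r D2).
Hypothesis dom : kn_domain D r th.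
Hypothesis DE : D r = (r ^ 2 + a ^ 2) * (1 - l * r ^ 2) - 2 * f.
Hypothesis D1E : D1 r = 2 * r * (1 - l * r ^ 2) - 2 * l * r * (r ^ 2 + a ^ 2) - 2 * f1.
Hypothesis D2E : D2 = 2 - 2 * l * a ^ 2 - 12 * l * r ^ 2 - 2 * f2.

Variables (g : coords -> 'M[R]_4) (x : coords).
Hypotheses (xr : x i_r = r) (xth : x i_th = th).
Hypothesis gE : forall y, kn_domain D (y i_r) (y i_th) ->
  g y = jet_mx (kn_jet b D D1 (y i_r) (y i_th)).

Let dens (V : 'I_4 -> R) : R := - (rho2 b r th * sin th / X) * (/ (8 * PI) *
  (sum4 (fun mu => einstein g mu i_t x * sum4 (fun al => g x mu al * V al))
   + Lambda b * V i_t)).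

Let P := rho2 b r th.
Let T := Delta_th b th.
Let s := sin th.
Let c := cos th.
Let P0 : P <> 0.
Proof. by apply: Rgt_not_eq; apply: rho2_gt0; case: dom. Qed.
Let X0 : X <> 0.
Proof. by rewrite /X; lra. Qed.
Let s0 : s <> 0.
Proof. by case: dom. Qed.
Let c2 : c ^ 2 = 1 - s ^ 2.
Proof. exact: cos_pow2. Qed.
Let PI0 : PI <> 0.
Proof. exact: PI_neq0. Qed.

Let LambdaE : Lambda b = 3 * l.
Proof. rewrite /Lambda /l /lam; field; lra. Qed.

(** All terms free of f cancel once Delta_r and its derivatives are written through f. As Y^t = 0,
    neither the scalar curvature nor Lambda contributes here, in contrast to K. *)
Lemma curvature_flux_Y : dens Yvec = Phi_Y f f1 f2 r th.
Proof.
rewrite /dens (kn_einstein_flux ell_gt0 Xi_gt0 DD dom DD1 xr xth gE (Xt := 0) (Xp := 1)) //.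
rewrite (_ : Yvec i_t = 0) // /row_th /d_row_r /d_row_th DE D1E D2E.
rewrite -/a -/X -/l -/P -/T -/s -/c /Phi_Y -/P -/s -/c /kap.
have -> : T = 1 + l * a ^ 2 * c ^ 2 by rewrite /T Delta_th_lam.
have r2 : r ^ 2 = P - a ^ 2 + a ^ 2 * s ^ 2 by rewrite /P /rho2 cos_pow2 /a /s; ring.
by field [c2 r2].
Qed.

Lemma curvature_flux_K : dens (Kvec b) = Phi_K f f1 f2 r th.
Proof.
have KE : Kvec b i_ph = l * a.
  by rewrite /Kvec /coord_form /= /l /lam /a; field; lra.
have KE0 : Kvec b i_t = 1 by rewrite /Kvec /coord_form /=; ring.
have KE1 : Kvec b i_r = 0 by rewrite /Kvec /coord_form /=; ring.
have KE2 : Kvec b i_th = 0 by rewrite /Kvec /coord_form /=; ring.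
rewrite /dens (kn_einstein_flux ell_gt0 Xi_gt0 DD dom DD1 xr xth gE KE0 KE1 KE2 KE).
rewrite (kn_scalar ell_gt0 Xi_gt0 DD dom DD1 xr xth gE) LambdaE KE0.
rewrite /row_th /d_row_r /d_row_th DE D1E D2E.
rewrite -/a -/X -/l -/P -/T -/s -/c /Phi_K -/P -/T -/s -/c /kap.
have -> : T = 1 + l * a ^ 2 * c ^ 2 by rewrite /T Delta_th_lam.
have r2 : r ^ 2 = P - a ^ 2 + a ^ 2 * s ^ 2 by rewrite /P /rho2 cos_pow2 /a /s; ring.
have XE : X = 1 + l * a ^ 2 by rewrite /X Xi_lam.
have l2 : l * a ^ 2 = X - 1 by rewrite XE; ring.
by field [c2 r2 l2].
Qed.

End Curvature.
Lemma is_derive_Delta_r m q r : class_C1 m -> class_C1 q ->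
  is_derive (Delta_r b m q) r (2 * r * (1 - l * r ^ 2) - 2 * l * r * (r ^ 2 + a ^ 2)
    - 2 * (Derive m r * r + m r - q r * Derive q r)).
Proof.
move=> [dm _] [dq _].
apply: (is_derive_ext (fun r => (r ^ 2 + a ^ 2) * (1 - l * r ^ 2) - 2 * m r * r + q r ^ 2)).
  by move=> t; rewrite (Delta_r_lam ell_gt0).
have xm := dm r; have xq := dq r; auto_derive; first by nonzero.
change (Derive (fun r => m r) r) with (Derive m r).
change (Derive (fun r => q r) r) with (Derive q r); ring.
Qed.

Lemma faraday_kn D q0 (x : coords) mu nu : kn_domain D (x i_r) (x i_th) ->
  (forall r th, kn_domain D r th ->
    locally r (fun s => kn_domain D s th) /\ locally th (kn_domain D r)) ->
  let P := rho2 b (x i_r) (x i_th) in let r := x i_r in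
  let s := sin (x i_th) in let c := cos (x i_th) in
  let u := q0 * (2 * r ^ 2 / P ^ 2 - / P) in
  let y := - (2 * a ^ 2 * s * c * q0 * r / P ^ 2) in
  faraday (kn_potential b (fun _ => q0)) mu nu x =
  faraday_entry u (- (a * s ^ 2 / X) * u) y
    (q0 * r * a / X * (2 * s * c / P + 2 * a ^ 2 * s ^ 3 * c / P ^ 2)) mu nu.
Proof.
move=> dom opn P r s c u y.
have P0 : P <> 0 by apply: Rgt_not_eq; apply: rho2_gt0; case: dom.
have X0 : X <> 0 by rewrite /X; lra.
pose F (i : nat) r th := - (q0 * r / rho2 b r th) *
  (if i is 0%N then 1 else if i is 3%N then - (a * sin th ^ 2 / X) else 0).
have FE i (z : coords) : kn_domain D (z i_r) (z i_th) ->
    kn_potential b (fun _ => q0) z i = F i (z i_r) (z i_th).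
  move=> _; rewrite /kn_potential /F /form_t /coord_form -/a -/X.
  elim/ord4P: i => /=; ring.
have dt i := pderiv_t (FE i) dom.
have dp i := pderiv_ph (FE i) dom.
have xP : ex_derive (fun s => rho2 b s (x i_th)) (x i_r) by eexists; exact: is_derive_rho2_r.
have xPt : ex_derive (rho2 b (x i_r)) (x i_th) by eexists; exact: is_derive_rho2_th.
have eP : Derive (fun s => rho2 b s (x i_th)) (x i_r) = 2 * r.
  exact: is_derive_unique (is_derive_rho2_r _ _ _).
have ePt : Derive (rho2 b (x i_r)) (x i_th) = - (2 * a ^ 2 * s * c).
  exact: is_derive_unique (is_derive_rho2_th _ _ _).
have dr (i : 'I_4) : pderiv i_r (fun z => kn_potential b (fun _ => q0) z i) x =
    u * (if nat_of_ord i is 0%N then 1 else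
         if nat_of_ord i is 3%N then - (a * s ^ 2 / X) else 0).
  apply: (pderiv_r opn (FE i) dom); rewrite /F.
  auto_derive; first by nonzero.
  rewrite eP -/P -/s -/r /u; by elim/ord4P: i => /=; field.
have dth (i : 'I_4) : pderiv i_th (fun z => kn_potential b (fun _ => q0) z i) x =
    if nat_of_ord i is 0%N then y else if nat_of_ord i is 3%N then
      q0 * r * a / X * (2 * s * c / P + 2 * a ^ 2 * s ^ 3 * c / P ^ 2) else 0.
  apply: (pderiv_th opn (FE i) dom); rewrite /F.
  elim/ord4P: i => /=; auto_derive; try (by nonzero); rewrite ?ePt -/P -/s -/c -/r /y;
  by field.
rewrite /faraday; elim/ord4P: mu; elim/ord4P: nu; rewrite ?dt ?dr ?dth ?dp /=; ring.
Qed.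

(* f = [mass_profile m q] satisfies Delta_r = (r^2 + a^2) (1 - lam r^2) - 2 f. *)
Definition mass_profile (m q : R -> R) (r : R) : R := m r * r - q r ^ 2 / 2.
Definition mass_profile1 (m q : R -> R) (r : R) : R :=
  Derive m r * r + m r - q r * Derive q r.
Definition mass_profile2 (m q : R -> R) (r : R) : R :=
  Derive (Derive m) r * r + 2 * Derive m r - Derive q r ^ 2 - q r * Derive (Derive q) r.

Lemma is_derive_mass_profile m q r : class_C1 m -> class_C1 q ->
  is_derive (mass_profile m q) r (mass_profile1 m q r).
Proof.
move=> [dm _] [dq _]; have xm := dm r; have xq := dq r.
rewrite /mass_profile /mass_profile1; auto_derive; first by nonzero.
change (Derive (fun r => m r) r) with (Derive m r).
by change (Derive (fun r => q r) r) with (Derive q r); field.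
Qed.

Lemma is_derive_mass_profile1 m q r : class_C1 m -> class_C1 q ->
  ex_derive (Derive m) r -> ex_derive (Derive q) r ->
  is_derive (mass_profile1 m q) r (mass_profile2 m q r).
Proof.
move=> [dm _] [dq _] xm1 xq1; have xm := dm r; have xq := dq r.
rewrite /mass_profile1 /mass_profile2; auto_derive; first by nonzero.
change (Derive (fun x => Derive (fun y => m y) x) r) with (Derive (Derive m) r).
change (Derive (fun x => Derive (fun y => q y) x) r) with (Derive (Derive q) r).
change (Derive (fun x => Derive m x) r) with (Derive (Derive m) r).
change (Derive (fun x => Derive q x) r) with (Derive (Derive q) r).
change (Derive (fun r => m r) r) with (Derive m r).
by change (Derive (fun r => q r) r) with (Derive q r); ring.
Qed.

(** For D = Delta_r, g^tt = - [gtt_numerator] / (rho2 Delta_r Delta_th); its zeros are the points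
    where the hypersurface of constant t is null. *)
Definition gtt_numerator (D : R -> R) (r th : R) : R :=
  Delta_th b th * (r ^ 2 + a ^ 2) ^ 2 - D r * a ^ 2 * sin th ^ 2.

Section KerrNewmanFlux.

Variables (m q : R -> R).
Hypotheses (m_C1 : class_C1 m) (q_C1 : class_C1 q).
Let D := Delta_r b m q.
Let D1 r := 2 * r * (1 - l * r ^ 2) - 2 * l * r * (r ^ 2 + a ^ 2) - 2 * mass_profile1 m q r.
Let DD : forall r, is_derive D r (D1 r).
Proof. by move=> r; exact: is_derive_Delta_r. Qed.

Variables (r th : R).
Hypotheses (r_gt0 : 0 < r) (th_int : 0 < th < PI) (D0 : D r <> 0).

Let dom : kn_domain D r th.
Proof. by split=> //; apply: Rgt_not_eq; apply: sin_gt_0; lra. Qed.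

Let vol := rho2 b r th * sin th / X.

(** |det g| = (rho2 sin / Xi)^2: Delta_r cancels between g_rr and the Killing block, so the density
    has the same form on both sides of a horizon. *)
Lemma kn_flux_density T V t0 ph : let x := bl_point t0 r th ph in
  flux_density (kn_metric b m q) T V t0 r th ph =
  if Req_EM_T (gtt_numerator D r th) 0 then 0 else - vol *
    sum4 (fun mu => T mu i_t x * sum4 (fun al => kn_metric b m q x mu al * V al)).
Proof.
move=> x.
have gx := kn_jet_metric ell_gt0 Xi_gt0 D1 (y := x) (fun r => erefl : D r = Delta_r b m q r) dom.
have P0 := rho2_gt0 b th r_gt0.
have T0 := Delta_th_gt0 ell_gt0 Xi_gt0 th.
have [d0 p0 q0 _ _ _ _ _ _ _ _ _ _ _ _] := kn_jet_regular ell_gt0 Xi_gt0 DD dom.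
have s0 : 0 < sin th by apply: sin_gt_0; lra.
have X0 : 0 < X by [].
have v0 : 0 < vol by apply: Rdiv_lt_0_compat => //; exact: Rmult_lt_0_compat.
rewrite (flux_density_block (vol := vol) T V gx d0 p0 q0) //; first last.
- rewrite /vol /x /bl_point /kn_jet /=.
  have r2 : r ^ 2 = rho2 b r th - a ^ 2 + a ^ 2 * sin th ^ 2.
    by rewrite /rho2 cos_pow2 /a; ring.
  rewrite -/a -/X -/D; field [r2].
  by do !split; (assumption || apply: Rgt_not_eq => //).
- by lra.
have E : hpp (kn_jet b D D1 r th) =
    (sin th ^ 2 / (X ^ 2 * rho2 b r th)) * gtt_numerator D r th.
  by rewrite /kn_jet /gtt_numerator /= -/a -/X; field; split; apply: Rgt_not_eq.
have n0 : sin th ^ 2 / (X ^ 2 * rho2 b r th) <> 0.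
  apply: Rgt_not_eq; apply: Rdiv_lt_0_compat; first exact: pow_lt.
  by apply: Rmult_lt_0_compat => //; exact: pow_lt.
rewrite [hpp _]E; case: Req_EM_T => h1; case: Req_EM_T => h2 //.
- by case: (Rmult_integral _ _ h1).
- by case: h1; rewrite h2 Rmult_0_r.
Qed.

Hypotheses (m_C2 : ex_derive (Derive m) r) (q_C2 : ex_derive (Derive q) r).

Let f := mass_profile m q r.
Let f1 := mass_profile1 m q r.
Let f2 := mass_profile2 m q r.

Let DD1 : is_derive D1 r (2 - 2 * l * a ^ 2 - 12 * l * r ^ 2 - 2 * f2).
Proof.
have d := is_derive_mass_profile1 m_C1 q_C1 m_C2 q_C2.
have xd : ex_derive (mass_profile1 m q) r by eexists; exact: d.
rewrite /D1; auto_derive; first by nonzero.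
rewrite (is_derive_unique _ _ _ d) /f2; ring.
Qed.

Lemma interpolating_flux_E V Phi t0 ph :
  (V = Kvec b /\ Phi = Phi_K f f1 f2 r th) \/ (V = Yvec /\ Phi = Phi_Y f f1 f2 r th) ->
  interpolating_flux b V t0 m q r th ph =
  if Req_EM_T (gtt_numerator D r th) 0 then 0 else Phi.
Proof.
move=> VPhi; rewrite /interpolating_flux kn_flux_density; case: Req_EM_T => //= _.
set x := bl_point t0 r th ph; set g := kn_metric b m q.
have gE y : kn_domain D (y i_r) (y i_th) -> g y = jet_mx (kn_jet b D D1 (y i_r) (y i_th)).
  exact: kn_jet_metric.
have [d0 p0 q0 _ _ _ _ _ _ _ _ _ _ _ _] := kn_jet_regular ell_gt0 Xi_gt0 DD dom.
have -> : sum4 (fun mu => (T_matter b m q mu i_t x + T_EM b m q mu i_t x) *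
      sum4 (fun al => g x mu al * V al)) = / (8 * PI) *
    (sum4 (fun mu => einstein g mu i_t x * sum4 (fun al => g x mu al * V al))
     + Lambda b * V i_t).
  rewrite -(inv_metric_lower V (gE x dom) d0 p0 q0).
  rewrite /T_matter /total_tensor -/g !(sum4E (fun mu => _ * sum4 _)).
  by ring.
have DE : D r = (r ^ 2 + a ^ 2) * (1 - l * r ^ 2) - 2 * f.
  by rewrite /D (Delta_r_lam ell_gt0) /f /mass_profile -/a -/l; field.
case: VPhi => [[-> ->]|[-> ->]].
- exact: (curvature_flux_K DD DD1 dom DE erefl erefl (x := x) erefl erefl gE).
- exact: (curvature_flux_Y DD DD1 dom DE erefl erefl (x := x) erefl erefl gE).
Qed.

End KerrNewmanFlux.

(** Only the components T^{mu t} V_mu are compared, directly from the Faraday tensor. The part m0 r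
    of f contributes nothing to [Phi], as Kerr-(anti-)de Sitter is a vacuum solution, so the density
    is proportional to q0^2. *)
Lemma em_flux_E (m0 q0 r th : R) V Phi t0 ph :
  0 < r -> 0 < th < PI -> Delta_r b (fun _ => m0) (fun _ => q0) r <> 0 ->
  let f := m0 * r - q0 ^ 2 / 2 in
  (V = Kvec b /\ Phi = Phi_K f m0 0 r th) \/ (V = Yvec /\ Phi = Phi_Y f m0 0 r th) ->
  em_flux b V t0 m0 q0 r th ph =
  if Req_EM_T (gtt_numerator (Delta_r b (fun _ => m0) (fun _ => q0)) r th) 0 then 0 else Phi.
Proof.
move=> r0 th_int D0 f VPhi.
have C1 k : class_C1 (fun _ : R => k).
  split=> z; first exact: ex_derive_const.
  apply: (continuous_ext (fun _ => 0)); first by move=> t; rewrite Derive_const.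
  exact: continuous_const.
rewrite /em_flux kn_flux_density //; case: Req_EM_T => //= _.
set x := bl_point t0 r th ph; pose D := Delta_r b (fun _ => m0) (fun _ => q0).
pose D1 r := 2 * r * (1 - l * r ^ 2) - 2 * l * r * (r ^ 2 + a ^ 2)
  - 2 * mass_profile1 (fun _ => m0) (fun _ => q0) r.
have DD z : is_derive D z (D1 z) by exact: is_derive_Delta_r.
have s0 : sin th <> 0 by apply: Rgt_not_eq; apply: sin_gt_0; lra.
have dom : kn_domain D r th by split.
have gx := kn_jet_metric ell_gt0 Xi_gt0 D1 (y := x) (fun r => erefl : D r = Delta_r b (fun _ => m0) (fun _ => q0) r) dom.
have [d0 p0 g0 _ _ _ _ _ _ _ _ _ _ _ _] := kn_jet_regular ell_gt0 Xi_gt0 DD dom.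
have Vr : V i_r = 0 by case: VPhi => [[-> _]|[-> _]]; rewrite /Kvec /Yvec /coord_form /=; ring.
have Vth : V i_th = 0 by case: VPhi => [[-> _]|[-> _]]; rewrite /Kvec /Yvec /coord_form /=; ring.
rewrite (em_flux_block gx d0 p0 g0 (fun mu nu => faraday_kn q0 mu nu (x := x) dom (kn_domain_open DD)) Vr Vth).
rewrite (_ : x i_r = r) // (_ : x i_th = th) //.
have PI0 := PI_neq0.
have X0 : X <> 0 by rewrite /X; lra.
have P0 : rho2 b r th <> 0 by apply: Rgt_not_eq; apply: rho2_gt0.
have T0 : Delta_th b th <> 0 by apply: Rgt_not_eq; apply: Delta_th_gt0.
have c2 := cos_pow2 th.
have r2 : r ^ 2 = rho2 b r th - a ^ 2 + a ^ 2 * sin th ^ 2.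
  by rewrite /rho2 cos_pow2 /a; ring.
have dE : htt (kn_jet b D D1 r th) * hpp (kn_jet b D D1 r th)
    - htp (kn_jet b D D1 r th) * htp (kn_jet b D D1 r th)
    = - (D r * Delta_th b th * sin th ^ 2 / X ^ 2).
  by rewrite /kn_jet /= -/a -/X; field [r2].
rewrite dE /kn_jet; cbv beta iota zeta delta [htt htp hpp grr ghh].
rewrite -/a -/X.
case: VPhi => [[-> ->]|[-> ->]].
- have -> : Kvec b i_ph = l * a.
    by rewrite /Kvec /coord_form /= /l /lam /a; field; lra.
  have -> : Kvec b i_t = 1 by rewrite /Kvec /coord_form /=; ring.
  rewrite /Phi_K /f /kap -/a -/l.
  have TE := Delta_th_lam ell_gt0 th; rewrite -/a -/l in TE.
  rewrite TE in T0 *.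
  have XE : X = 1 + l * a ^ 2 by rewrite /X Xi_lam.
  have l2 : l * a ^ 2 = X - 1 by rewrite XE; ring.
  by field [c2 r2 l2].
- change (Yvec i_ph) with 1; change (Yvec i_t) with 0; rewrite /Phi_Y /f /kap -/a.
  by field [c2 r2].
Qed.

End FluxDensity.

(** * Integrals over the polar angle *)

Lemma is_lim_mult_finite (f g : R -> R) (x : Rbar) (lf lg : R) :
  is_lim f x lf -> is_lim g x lg -> is_lim (fun y => f y * g y) x (lf * lg).
Proof. by move=> Lf Lg; apply: (is_lim_mult _ _ _ _ _ Lf Lg). Qed.

Section AngularIntegrals.

Variable b : background.
Hypotheses (ell_gt0 : 0 < ell b) (Xi_gt0 : 0 < Xi b).
Let a := spin b.
Let X := Xi b.
Let l := lam b.
Let kap := / (16 * PI * X ^ 2).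

(** For a <> 0 this is arctan (a x) / a; the integral form also covers a = 0. *)
Definition prim0 (x : R) : R := RInt (fun t => / (1 + a ^ 2 * t ^ 2)) 0 x.
Definition prim2 (x : R) : R := RInt (fun t => t ^ 2 / (1 + a ^ 2 * t ^ 2)) 0 x.

Lemma den_neq0 t : 1 + a ^ 2 * t ^ 2 <> 0.
Proof. have := pow2_ge_0 (a * t); rewrite Rpow_mult_distr; lra. Qed.

Lemma is_derive_prim (f : R -> R) x : (forall t, continuous f t) ->
  is_derive (fun x => RInt f 0 x) x (f x).
Proof.
move=> fc; apply: (is_derive_RInt f _ 0); last exact: fc.
by apply: filter_forall => y; apply: RInt_correct; apply: ex_RInt_continuous => z _; exact: fc.
Qed.

Lemma is_derive_prim0 x : is_derive prim0 x (/ (1 + a ^ 2 * x ^ 2)).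
Proof.
apply: (is_derive_prim (f := fun t => / (1 + a ^ 2 * t ^ 2))) => t.
have t0 := @den_neq0 t; apply: ex_derive_continuous; by auto_derive.
Qed.

Lemma is_derive_prim2 x : is_derive prim2 x (x ^ 2 / (1 + a ^ 2 * x ^ 2)).
Proof.
apply: (is_derive_prim (f := fun t => t ^ 2 / (1 + a ^ 2 * t ^ 2))) => t.
have t0 := @den_neq0 t; apply: ex_derive_continuous; by auto_derive.
Qed.

(* The integrals of sin / rho2 and sin cos^2 / rho2 over 0 < theta < PI, by the
   substitution cos theta = r t. *)
Definition I0 (r : R) : R := (prim0 (/ r) - prim0 (- / r)) / r.
Definition I2 (r : R) : R := r * (prim2 (/ r) - prim2 (- / r)).

(** [I0] and [I2] satisfy first-order linear equations with rational coefficients, so every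
    r-derivative needed below is again an expression in [I0], [I2] and r. *)
Lemma is_derive_I0 r : 0 < r -> is_derive I0 r (- (2 / (r ^ 2 + a ^ 2) + I0 r) / r).
Proof.
move=> r0; have A0 : r ^ 2 + a ^ 2 <> 0 by have := pow2_ge_0 a; have := pow_lt r 2 r0; lra.
have d1 := is_derive_prim0 (/ r); have d2 := is_derive_prim0 (- / r).
have x1 : ex_derive prim0 (/ r) by eexists; exact: d1.
have x2 : ex_derive prim0 (- / r) by eexists; exact: d2.
rewrite /I0; auto_derive; first by nonzero.
rewrite (is_derive_unique _ _ _ d1) (is_derive_unique _ _ _ d2).
have n1 := @den_neq0 (/ r); have n2 := @den_neq0 (- / r).
field; nonzero.
Qed.

Lemma is_derive_I2 r : 0 < r -> is_derive I2 r ((I2 r - 2 / (r ^ 2 + a ^ 2)) / r).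
Proof.
move=> r0; have A0 : r ^ 2 + a ^ 2 <> 0 by have := pow2_ge_0 a; have := pow_lt r 2 r0; lra.
have d1 := is_derive_prim2 (/ r); have d2 := is_derive_prim2 (- / r).
have x1 : ex_derive prim2 (/ r) by eexists; exact: d1.
have x2 : ex_derive prim2 (- / r) by eexists; exact: d2.
rewrite /I2; auto_derive; first by nonzero.
rewrite (is_derive_unique _ _ _ d1) (is_derive_unique _ _ _ d2).
have n1 := @den_neq0 (/ r); have n2 := @den_neq0 (- / r).
field; nonzero.
Qed.

Lemma is_derive_angle0 r th : 0 < r ->
  is_derive (fun th => - (prim0 (cos th / r) / r)) th (sin th / rho2 b r th).
Proof.
move=> r0; have P0 := Rgt_not_eq _ _ (rho2_gt0 b th r0); rewrite /rho2 -/a in P0.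
have d1 := is_derive_prim0 (cos th / r).
have x1 : ex_derive prim0 (cos th / r) by eexists; exact: d1.
auto_derive; first by nonzero.
rewrite (is_derive_unique _ _ _ d1); have n1 := @den_neq0 (cos th / r).
by rewrite /rho2 -/a; field; nonzero.
Qed.

Lemma is_derive_angle2 r th : 0 < r ->
  is_derive (fun th => - (r * prim2 (cos th / r))) th (sin th * cos th ^ 2 / rho2 b r th).
Proof.
move=> r0; have P0 := Rgt_not_eq _ _ (rho2_gt0 b th r0); rewrite /rho2 -/a in P0.
have d1 := is_derive_prim2 (cos th / r).
have x1 : ex_derive prim2 (cos th / r) by eexists; exact: d1.
auto_derive; first by nonzero.
rewrite (is_derive_unique _ _ _ d1); have n1 := @den_neq0 (cos th / r).
by rewrite /rho2 -/a; field; nonzero.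
Qed.

(* [al] and [de] are the coefficients of f' and f in the integral of U over theta, [al1] and
   [de1] their r-derivatives. *)
Definition al_K r := - (2 * kap * a ^ 2 * (1 - l * r ^ 2) * (I0 r - I2 r)).
Definition al1_K r := - (2 * kap * a ^ 2 *
  (- (2 * l * r * (I0 r - I2 r)) - (1 - l * r ^ 2) * (I0 r + I2 r) / r)).
Definition de_K r := let A := r ^ 2 + a ^ 2 in
  kap * (2 / r * (A * I0 r + 2 + l * a ^ 2 * (2 - A * I2 r))
         - 4 * l * r * a ^ 2 * (I0 r - I2 r)).
Definition de1_K r := let A := r ^ 2 + a ^ 2 in
  kap * (- (2 / r ^ 2 * (A * I0 r + 2 + l * a ^ 2 * (2 - A * I2 r)))
    + 2 / r * (2 * r * I0 r - (2 + A * I0 r) / r - l * a ^ 2 * (2 * r * I2 r + (A * I2 r - 2) / r))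
    + 8 * l * a ^ 2 * I2 r).

Definition al_Y r := 2 * kap * a * (r ^ 2 + a ^ 2) * (I0 r - I2 r).
Definition al1_Y r := 2 * kap * a * (2 * r * (I0 r - I2 r) - (r ^ 2 + a ^ 2) * (I0 r + I2 r) / r).
Definition de_Y r :=
  - (kap * a * (4 * r * (I0 r - I2 r) + 2 * (r ^ 2 + a ^ 2) / r * (I0 r + I2 r))).
Definition de1_Y r := let A := r ^ 2 + a ^ 2 in
  kap * a * (8 * I2 r - 2 * (1 - a ^ 2 / r ^ 2) * (I0 r + I2 r)
             - 2 * A / r ^ 2 * (I2 r - I0 r - 4 / A)).

Lemma Derive_I r : 0 < r ->
  [/\ ex_derive I0 r, ex_derive I2 r,
      Derive (fun x => I0 x) r = - (2 / (r ^ 2 + a ^ 2) + I0 r) / r,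
      Derive (fun x => I2 x) r = (I2 r - 2 / (r ^ 2 + a ^ 2)) / r & r ^ 2 + a ^ 2 <> 0].
Proof.
move=> r0; have d0 := is_derive_I0 r0; have d2 := is_derive_I2 r0; split.
- by eexists; exact: d0.
- by eexists; exact: d2.
- exact: is_derive_unique d0.
- exact: is_derive_unique d2.
- by have := pow2_ge_0 a; have := pow_lt r 2 r0; lra.
Qed.

Lemma is_derive_al_K r : 0 < r -> is_derive al_K r (al1_K r).
Proof.
move=> r0; have [x0 x2 e0 e2 A0] := Derive_I r0; rewrite /al_K /al1_K.
by auto_derive; [nonzero | rewrite e0 e2; field; nonzero].
Qed.

Lemma is_derive_de_K r : 0 < r -> is_derive de_K r (de1_K r).
Proof.
move=> r0; have [x0 x2 e0 e2 A0] := Derive_I r0; rewrite /de_K /de1_K.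
by auto_derive; [nonzero | rewrite e0 e2; field; nonzero].
Qed.

Lemma is_derive_al_Y r : 0 < r -> is_derive al_Y r (al1_Y r).
Proof.
move=> r0; have [x0 x2 e0 e2 A0] := Derive_I r0; rewrite /al_Y /al1_Y.
by auto_derive; [nonzero | rewrite e0 e2; field; nonzero].
Qed.

Lemma is_derive_de_Y r : 0 < r -> is_derive de_Y r (de1_Y r).
Proof.
move=> r0; have [x0 x2 e0 e2 A0] := Derive_I r0; rewrite /de_Y /de1_Y.
by auto_derive; [nonzero | rewrite e0 e2; field; nonzero].
Qed.


Lemma continuous_al1_K r : 0 < r -> continuous al1_K r.
Proof.
move=> r0; have [x0 x2 e0 e2 A0] := Derive_I r0; rewrite /al1_K.
by apply: ex_derive_continuous; auto_derive; nonzero.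
Qed.

Lemma continuous_de1_K r : 0 < r -> continuous de1_K r.
Proof.
move=> r0; have [x0 x2 e0 e2 A0] := Derive_I r0; rewrite /de1_K.
by apply: ex_derive_continuous; auto_derive; nonzero.
Qed.

Lemma continuous_al1_Y r : 0 < r -> continuous al1_Y r.
Proof.
move=> r0; have [x0 x2 e0 e2 A0] := Derive_I r0; rewrite /al1_Y.
by apply: ex_derive_continuous; auto_derive; nonzero.
Qed.

Lemma continuous_de1_Y r : 0 < r -> continuous de1_Y r.
Proof.
move=> r0; have [x0 x2 e0 e2 A0] := Derive_I r0; rewrite /de1_Y.
by apply: ex_derive_continuous; auto_derive; nonzero.
Qed.


Section Antiderivative.

Variables (r f f1 f2 : R).
Hypothesis r0 : 0 < r.
Let A := r ^ 2 + a ^ 2.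
Let L := 1 - l * r ^ 2.
Let A0 : A <> 0.
Proof. by have [] := Derive_I r0. Qed.
Let X0 : X <> 0.
Proof. by apply: Rgt_not_eq. Qed.
Let PI0 : PI <> 0 := PI_neq0.

(** Hermite reduction: modulo an exact theta-derivative the integrand is a combination of sin / rho2
    and sin cos^2 / rho2, which integrate to [I0] and [I2]. *)
Lemma is_RInt_angle (Phi : R -> R) (Z : R -> R) (c0 c2 : R) :
  (forall th, continuous Phi th) ->
  (forall th, is_derive Z th
     (Phi th - c0 * (sin th / rho2 b r th) - c2 * (sin th * cos th ^ 2 / rho2 b r th))) ->
  is_RInt Phi 0 PI (c0 * I0 r + c2 * I2 r + Z PI - Z 0).
Proof.
move=> cPhi dZ.
pose W th := c0 * - (prim0 (cos th / r) / r) + c2 * - (r * prim2 (cos th / r)) + Z th.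
have -> : c0 * I0 r + c2 * I2 r + Z PI - Z 0 = minus (W PI) (W 0).
  rewrite /W /minus /plus /opp /= cos_PI cos_0 /I0 /I2.
  have -> : -1 / r = - / r by field; lra.
  have -> : 1 / r = / r by field; lra.
  by field; lra.
apply: is_RInt_derive => th _; last exact: cPhi.
have d0 := is_derive_angle0 th r0; have d2 := is_derive_angle2 th r0.
have := is_derive_plus _ _ _ _ _ (is_derive_plus _ _ _ _ _ (is_derive_scal _ _ c0 _ d0)
  (is_derive_scal _ _ c2 _ d2)) (dZ th).
rewrite /plus /= /scal /= /mult /=.
set v := (X in is_derive _ _ X); set u := (X in _ -> is_derive _ _ X).
by have -> : v = u by rewrite /v /u; ring.
Qed.

(** d_r (A f / (r rho2)), the r-dependence of the auxiliary function z. *)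
Let dAf P := (2 * r * f + A * f1) / (r * P) - A * f / (r ^ 2 * P) - 2 * A * f / P ^ 2.

Lemma jet_th th : [/\ rho2 b r th <> 0, Delta_th b th <> 0,
  ex_derive (rho2 b r) th, ex_derive (Delta_th b) th &
  Derive (fun t => rho2 b r t) th = - (2 * a ^ 2 * sin th * cos th) /\
  Derive (fun t => Delta_th b t) th = - (2 * l * a ^ 2 * sin th * cos th)].
Proof.
have dP := is_derive_rho2_th b r th; have dT := is_derive_Delta_th ell_gt0 th.
split.
- exact: Rgt_not_eq _ _ (rho2_gt0 b th r0).
- exact: Rgt_not_eq _ _ (Delta_th_gt0 ell_gt0 Xi_gt0 th).
- by eexists; exact: dP.
- by eexists; exact: dT.
- split; [exact: is_derive_unique dP | exact: is_derive_unique dT].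
Qed.

(* Modulo theta-derivatives U and Phi are combinations of sin / P and sin cos^2 / P:
   U = E1 sin / P + E2 sin cos^2 / P + d_theta z and, as d_r (sin / P) and d_r (sin cos^2 / P)
   reduce to the same functions, Z = V + d_r z + (E1 cos + E2 cos^3) / (r P). *)
Lemma is_RInt_Phi_K :
  is_RInt (Phi_K b f f1 f2 r) 0 PI (al_K r * f2 + (al1_K r + de_K r) * f1 + de1_K r * f).
Proof.
(* [dA], [E1'] and [E2'] are the r-derivatives of A f / r, [E1] and [E2]. *)
pose dA := (2 * r * f + A * f1) / r - A * f / r ^ 2.
pose E1 := - (2 * a ^ 2 * L * f1) + 2 * A * f / r - 4 * l * r * a ^ 2 * f.
pose E2 := 2 * a ^ 2 * L * f1 - 2 * l * a ^ 2 * A * f / r + 4 * l * r * a ^ 2 * f.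
pose E1' := - (2 * a ^ 2 * (L * f2 - 2 * l * r * f1)) + 2 * dA - 4 * l * a ^ 2 * (f + r * f1).
pose E2' := 2 * a ^ 2 * (L * f2 - 2 * l * r * f1) - 2 * l * a ^ 2 * dA + 4 * l * a ^ 2 * (f + r * f1).
pose Z th := let P := rho2 b r th in let s := sin th in let c := cos th in
  kap * (- (4 * a ^ 2 * s ^ 2 * c * Delta_th b th * f / P ^ 2)
         - 2 * c * Delta_th b th * dAf P + (E1 * c + E2 * c ^ 3) / (r * P)).
(* The coefficients come from d_r (sin / P) = d_theta (cos / (r P)) - sin / (r P) and d_r (sin cos^2
   / P) = d_theta (cos^3 / (r P)) + sin cos^2 / (r P). *)
have := @is_RInt_angle (Phi_K b f f1 f2 r) Z (kap * (E1' - E1 / r)) (kap * (E2' + E2 / r)).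
set v := (X in _ -> _ -> is_RInt _ _ _ X).
have -> : v = al_K r * f2 + (al1_K r + de_K r) * f1 + de1_K r * f.
  rewrite /v /Z /E1' /E2' /E1 /E2 /dA /dAf /al_K /al1_K /de_K /de1_K /L.
  rewrite !(Delta_th_lam ell_gt0) /rho2 sin_PI sin_0 cos_PI cos_0 -/a -/l -/A.
  have l2 : l * a ^ 2 = X - 1 by rewrite /X (Xi_lam ell_gt0) -/a -/l; ring.
  move: (I0 r) (I2 r) => i0 i2; have A1 := A0; rewrite /kap /A in A1 *.
  field; nonzero.
apply=> th; have [P0 T0 xP xT [eP eT]] := jet_th th.
  by apply: ex_derive_continuous; rewrite /Phi_K; cbv zeta; auto_derive; nonzero.
rewrite /Z; cbv zeta; rewrite /dAf; auto_derive; first by nonzero.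
rewrite eP eT /Phi_K -/a -/X -/l -/kap -/A -/L /E1' /E2' /E1 /E2 /dA.
have c2 := cos_pow2 th.
have r2 : r ^ 2 = rho2 b r th - a ^ 2 + a ^ 2 * sin th ^ 2.
  by rewrite /rho2 cos_pow2 /a; ring.
have l2 : l * a ^ 2 * sin th ^ 2 = 1 + l * a ^ 2 - Delta_th b th.
  by rewrite (Delta_th_lam ell_gt0) -/l -/a c2; ring.
move: (kap) => k; rewrite /L /A.
field [c2 r2 l2]; nonzero.
Qed.

Lemma is_RInt_Phi_Y :
  is_RInt (Phi_Y b f f1 f2 r) 0 PI (al_Y r * f2 + (al1_Y r + de_Y r) * f1 + de1_Y r * f).
Proof.
pose dA := (2 * r * f + A * f1) / r - A * f / r ^ 2.
pose E1 := a * (2 * A * f1 - 4 * r * f - 2 * A * f / r).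
pose E2 := a * (- (2 * A * f1) + 4 * r * f - 2 * A * f / r).
pose E1' := a * (2 * A * f2 - 4 * f - 2 * dA).
pose E2' := a * (- (2 * A * f2) + 4 * f - 2 * dA).
pose Z th := let P := rho2 b r th in let s := sin th in let c := cos th in
  kap * (4 * a ^ 3 * s ^ 4 * c * f / P ^ 2
         + 2 * a * c * s ^ 2 * dAf P + (E1 * c + E2 * c ^ 3) / (r * P)).
have := @is_RInt_angle (Phi_Y b f f1 f2 r) Z (kap * (E1' - E1 / r)) (kap * (E2' + E2 / r)).
set v := (X in _ -> _ -> is_RInt _ _ _ X).
have -> : v = al_Y r * f2 + (al1_Y r + de_Y r) * f1 + de1_Y r * f.
  rewrite /v /Z /E1' /E2' /E1 /E2 /dA /dAf /al_Y /al1_Y /de_Y /de1_Y.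
  rewrite /rho2 sin_PI sin_0 cos_PI cos_0 -/a -/l -/A.
  move: (I0 r) (I2 r) => i0 i2; have A1 := A0; rewrite /kap /A in A1 *.
  field; nonzero.
apply=> th; have [P0 T0 xP xT [eP eT]] := jet_th th.
  by apply: ex_derive_continuous; rewrite /Phi_Y; cbv zeta; auto_derive; nonzero.
rewrite /Z; cbv zeta; rewrite /dAf; auto_derive; first by nonzero.
rewrite eP /Phi_Y -/a -/X -/l -/kap -/A /E1' /E2' /E1 /E2 /dA.
have c2 := cos_pow2 th.
have r2 : r ^ 2 = rho2 b r th - a ^ 2 + a ^ 2 * sin th ^ 2.
  by rewrite /rho2 cos_pow2 /a; ring.
move: (kap) => k; rewrite /A.
field [c2 r2]; nonzero.
Qed.

End Antiderivative.

(** From r^2 <= rho2 <= r^2 + a^2 under the integral sign. These bounds already determine the limits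
    of r^2 [I0] and r^2 [I2]. *)
Lemma I_bounds r : 0 < r ->
  2 / (r ^ 2 + a ^ 2) <= I0 r <= 2 / r ^ 2 /\
  2 / 3 / (r ^ 2 + a ^ 2) <= I2 r <= 2 / 3 / r ^ 2.
Proof.
move=> r0; have rr := pow_lt r 2 r0.
have A0 : 0 < r ^ 2 + a ^ 2 by have := pow2_ge_0 a; lra.
have P0 th := rho2_gt0 b th r0.
have c0 k th : continuous (fun th => sin th / k) th.
  by apply: ex_derive_continuous; auto_derive.
have c2 k th : continuous (fun th => sin th * cos th ^ 2 / k) th.
  by apply: ex_derive_continuous; auto_derive.
have i0 k : k <> 0 -> is_RInt (fun th => sin th / k) 0 PI (2 / k).
  move=> k0; have -> : 2 / k = minus (- (cos PI / k)) (- (cos 0 / k)).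
    by rewrite /minus /plus /opp /= cos_PI cos_0; field.
  apply: (is_RInt_derive (fun th => - (cos th / k))) => th _ //.
  by auto_derive => //; field.
have i2 k : k <> 0 -> is_RInt (fun th => sin th * cos th ^ 2 / k) 0 PI (2 / 3 / k).
  move=> k0; have -> : 2 / 3 / k = minus (- (cos PI ^ 3 / (3 * k))) (- (cos 0 ^ 3 / (3 * k))).
    by rewrite /minus /plus /opp /= cos_PI cos_0; field.
  apply: (is_RInt_derive (fun th => - (cos th ^ 3 / (3 * k)))) => th _ //.
  by auto_derive; [nonzero | field].
have zero th (u : R) : u = 0 -> is_derive (fun _ : R => 0) th u.
  by move=> ->; exact: is_derive_const.
have j0 : is_RInt (fun th => sin th / rho2 b r th) 0 PI (I0 r).
  have -> : I0 r = 1 * I0 r + 0 * I2 r + 0 - 0 by ring.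
  apply: (is_RInt_angle r0 (Z := fun _ => 0)) => th.
    have x := ex_intro _ _ (is_derive_rho2_th b r th) : ex_derive (rho2 b r) th.
    have p := Rgt_not_eq _ _ (P0 th).
    by apply: ex_derive_continuous; auto_derive; nonzero.
  by apply: zero; ring.
have j2 : is_RInt (fun th => sin th * cos th ^ 2 / rho2 b r th) 0 PI (I2 r).
  have -> : I2 r = 0 * I0 r + 1 * I2 r + 0 - 0 by ring.
  apply: (is_RInt_angle r0 (Z := fun _ => 0)) => th.
    have x := ex_intro _ _ (is_derive_rho2_th b r th) : ex_derive (rho2 b r) th.
    have p := Rgt_not_eq _ _ (P0 th).
    by apply: ex_derive_continuous; auto_derive; nonzero.
  by apply: zero; ring.
have Pub th : rho2 b r th <= r ^ 2 + a ^ 2.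
  have := cos_pow2 th; have := pow2_ge_0 (sin th); have := pow2_ge_0 a.
  rewrite /rho2 -/a; move: (sin th ^ 2) (cos th ^ 2) (a ^ 2) => u v w *; nra.
have Plb th : r ^ 2 <= rho2 b r th.
  by have := pow2_ge_0 (a * cos th); rewrite Rpow_mult_distr /rho2 -/a; lra.
have le_inv u v w : 0 <= u -> 0 < v -> v <= w -> u / w <= u / v.
  by move=> u0 v0 vw; apply: Rmult_le_compat_l => //; apply: Rinv_le_contravar.
have n0 := PI_RGT_0.
have s0 th : 0 < th < PI -> 0 <= sin th by move=> ?; apply: sin_ge_0; lra.
have s2 th : 0 < th < PI -> 0 <= sin th * cos th ^ 2.
  by move=> ?; apply: Rmult_le_pos; [exact: s0 | exact: pow2_ge_0].
have rn := Rgt_not_eq _ _ rr; have An := Rgt_not_eq _ _ A0.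
have PI_ge0 : 0 <= PI by lra.
split; split.
- by apply: (is_RInt_le _ _ 0 PI _ _ PI_ge0 (i0 _ An) j0) => th ?; apply: le_inv; auto.
- by apply: (is_RInt_le _ _ 0 PI _ _ PI_ge0 j0 (i0 _ rn)) => th ?; apply: le_inv; auto.
- by apply: (is_RInt_le _ _ 0 PI _ _ PI_ge0 (i2 _ An) j2) => th ?; apply: le_inv; auto.
- by apply: (is_RInt_le _ _ 0 PI _ _ PI_ge0 j2 (i2 _ rn)) => th ?; apply: le_inv; auto.
Qed.

Lemma is_lim_inv_infty : is_lim Rinv p_infty 0.
Proof. by apply: (is_lim_inv (fun x => x) p_infty p_infty); [exact: is_lim_id|]. Qed.

Lemma is_lim_squeezed (F : R -> R) (k : R) : 0 < k ->
  (forall r, 0 < r -> k / (r ^ 2 + a ^ 2) <= F r <= k / r ^ 2) ->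
  is_lim (fun r => r ^ 2 * F r) p_infty k.
Proof.
move=> k0 FE.
apply: (is_lim_le_le_loc (fun r => k - k * a ^ 2 * (/ r * / r)) (fun _ => k)); last first.
- exact: is_lim_const.
- have := is_lim_minus' _ _ _ _ _ (is_lim_const k p_infty) (is_lim_mult_finite
    (is_lim_const (k * a ^ 2) p_infty) (is_lim_mult_finite is_lim_inv_infty is_lim_inv_infty)).
  by rewrite !Rmult_0_r Rminus_0_r.
exists 0 => r r0; have rr := pow_lt r 2 r0; have [lb ub] := FE r r0.
have A0 : 0 < r ^ 2 + a ^ 2 by have := pow2_ge_0 a; lra.
split.
- apply: (Rle_trans _ (r ^ 2 * (k / (r ^ 2 + a ^ 2)))); last by apply: Rmult_le_compat_l; lra.
  apply: Rminus_le.
  have -> : k - k * a ^ 2 * (/ r * / r) - r ^ 2 * (k / (r ^ 2 + a ^ 2)) =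
    - (k * a ^ 4 / (r ^ 2 * (r ^ 2 + a ^ 2))) by field; split; lra.
  apply: Ropp_le_cancel; rewrite Ropp_0 Ropp_involutive.
  apply: Rdiv_le_0_compat; last exact: Rmult_lt_0_compat.
  apply: Rmult_le_pos; first lra.
  have -> : a ^ 4 = (a ^ 2) ^ 2 by ring.
  exact: pow2_ge_0.
- have -> : k = r ^ 2 * (k / r ^ 2) by field; lra.
  by apply: Rmult_le_compat_l; lra.
Qed.

(** In x = r^2 I0, y = r^2 I2 and t = 1 / r the expression is a polynomial, and (x, y, t) tends to
    (2, 2/3, 0). There the terms with lam a^2 cancel (8/3 + 8/3 - 16/3); the factor 2 PI from phi
    turns 8 kap m0 into m0 / Xi^2. *)
Lemma is_lim_K m0 q0 :
  is_lim (fun r => al_K r * m0 + de_K r * (m0 * r - q0 ^ 2 / 2)) p_infty (8 * kap * m0).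
Proof.
have x0 : is_lim (fun r => r ^ 2 * I0 r) p_infty 2.
  by apply: is_lim_squeezed => [|r r0]; [lra | case: (I_bounds r0)].
have x2 : is_lim (fun r => r ^ 2 * I2 r) p_infty (2 / 3).
  by apply: is_lim_squeezed => [|r r0]; [lra | case: (I_bounds r0)].
have xi := is_lim_inv_infty.
pose F x y t := kap * (-2 * a ^ 2 * m0 * (t * t - l) * (x - y)
  + 2 * (x * (1 + a ^ 2 * (t * t)) + 2 + l * a ^ 2 * (2 - y * (1 + a ^ 2 * (t * t))))
    * (m0 - q0 ^ 2 / 2 * t)
  - 4 * l * a ^ 2 * (x - y) * (m0 - q0 ^ 2 / 2 * t)).
have -> : 8 * kap * m0 = F 2 (2 / 3) 0 by rewrite /F; field.
apply: (is_lim_ext_loc (fun r => F (r ^ 2 * I0 r) (r ^ 2 * I2 r) (/ r))).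
  exists 0 => r r0; rewrite /F /al_K /de_K; field; lra.
rewrite /F.
repeat first [ exact: x0 | exact: x2 | exact: xi | apply: is_lim_const
  | apply: is_lim_minus' | apply: is_lim_plus' | apply: is_lim_mult_finite ].
Qed.

Lemma is_lim_Y m0 q0 :
  is_lim (fun r => al_Y r * m0 + de_Y r * (m0 * r - q0 ^ 2 / 2)) p_infty (- (8 * kap * a * m0)).
Proof.
have x0 : is_lim (fun r => r ^ 2 * I0 r) p_infty 2.
  by apply: is_lim_squeezed => [|r r0]; [lra | case: (I_bounds r0)].
have x2 : is_lim (fun r => r ^ 2 * I2 r) p_infty (2 / 3).
  by apply: is_lim_squeezed => [|r r0]; [lra | case: (I_bounds r0)].
have xi := is_lim_inv_infty.
pose F x y t := kap * a * (2 * (1 + a ^ 2 * (t * t)) * (x - y) * m0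
  - (4 * (x - y) + 2 * (1 + a ^ 2 * (t * t)) * (x + y)) * (m0 - q0 ^ 2 / 2 * t)).
have -> : - (8 * kap * a * m0) = F 2 (2 / 3) 0 by rewrite /F; field.
apply: (is_lim_ext_loc (fun r => F (r ^ 2 * I0 r) (r ^ 2 * I2 r) (/ r))).
  exists 0 => r r0; rewrite /F /al_Y /de_Y; field; lra.
rewrite /F.
repeat first [ exact: x0 | exact: x2 | exact: xi | apply: is_lim_const
  | apply: is_lim_minus' | apply: is_lim_plus' | apply: is_lim_mult_finite ].
Qed.

End AngularIntegrals.

(** * Shell and exterior integrals *)

Lemma finite_roots (p : {poly R}) : (p != 0)%R ->
  exists s : seq R, forall x, root p x -> List.In x s.
Proof.
have [n le_n] := ubnP (size p); elim: n p le_n => // n IH p le_n p0.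
have [[x rx]|no] := classic (exists x, root p x); last first.
  by exists [::] => x rx; case: no; exists x.
have [q pE] := factor_theorem _ _ rx.
have q0 : (q != 0)%R by apply: contra_neq p0 => q0; rewrite pE q0 GRing.mul0r.
have [|s sP] := IH q _ q0.
  by move: le_n; rewrite pE size_Mmonic ?monicXsubC // size_XsubC addn2.
exists (x :: s) => y; rewrite pE rootM root_XsubC => /orP [/sP|/eqP ->]; first by right.
by left.
Qed.

(** Splitting the interval at an exceptional point makes it an endpoint, where the values of the
    integrands do not matter. *)
Lemma is_RInt_ext_finite (s : seq R) (f g : R -> R) (a b v : R) : a <= b ->
  (forall x, a < x < b -> ~ List.In x s -> f x = g x) -> is_RInt f a b v -> is_RInt g a b v.
Proof.
elim: s a b v => [|c s IH] a b v ab fg If.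
  by apply: is_RInt_ext If; rewrite Rmin_left // Rmax_right // => x xab; apply: fg.
have [cab|ncab] := classic (a < c < b); last first.
  apply: IH If => // x xab xs; apply: fg => // - [cx|//].
  by apply: ncab; rewrite cx.
have xf : ex_RInt f a b by exists v.
have [v1 I1] : ex_RInt f a c by apply: ex_RInt_Chasles_1 xf; lra.
have [v2 I2] : ex_RInt f c b by apply: ex_RInt_Chasles_2 xf; lra.
have -> : v = plus v1 v2.
  by rewrite -(is_RInt_unique _ _ _ _ If); apply: is_RInt_unique; apply: is_RInt_Chasles I1 I2.
apply: (is_RInt_Chasles _ _ c).
- apply: IH I1 => [|x xac xs]; first lra.
  by apply: fg => [|[cx|//]]; lra.
- apply: IH I2 => [|x xac xs]; first lra.
  by apply: fg => [|[cx|//]]; lra.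
Qed.

Lemma sin_sqr_finite (z : R) :
  exists s : seq R, forall th, 0 < th < PI -> sin th ^ 2 = z -> List.In th s.
Proof.
exists [:: asin (sqrt z); PI - asin (sqrt z)] => th th_int thz.
have s0 : 0 <= sin th by apply: sin_ge_0; lra.
rewrite -thz sqrt_pow2 //=.
have [le_th|gt_th] := Rle_lt_dec th (PI / 2).
  by left; rewrite asin_sin; lra.
right; left; have -> : sin th = sin (PI - th) by rewrite sin_PI_x.
by rewrite asin_sin; lra.
Qed.

(** F is constant in phi at every theta, as integrability in phi demands; at the finitely many null
    angles this constant may differ from [Ph]. *)
Lemma angular_integral_E (F : R -> R -> R -> R) (Ph : R -> R) (r v : R) (s : seq R) :
  (forall th, 0 < th < PI -> exists k, (forall ph, F r th ph = k) /\
     (~ List.In th s -> k = Ph th)) ->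
  is_RInt Ph 0 PI v -> angular_integrable F r /\ angular_integral F r = 2 * PI * v.
Proof.
move=> FE IPh; have PI0 := PI_RGT_0.
have I th : 0 < th < PI -> ~ List.In th s ->
    2 * PI * Ph th = RInt (fun ph => F r th ph) 0 (2 * PI).
  move=> th_int th_s; have [k [Fk kE]] := FE th th_int.
  rewrite (RInt_ext _ (fun _ => k)) => [|ph _]; last exact: Fk.
  by rewrite RInt_const kE // /scal /= /mult /=; ring.
have If : is_RInt (fun th => RInt (fun ph => F r th ph) 0 (2 * PI)) 0 PI (2 * PI * v).
  apply: (is_RInt_ext_finite (s := s) (f := fun th => 2 * PI * Ph th)) => //; first lra.
  exact: is_RInt_scal.
split; last exact: is_RInt_unique.
split=> [th th_int|]; last by eexists; exact: If.
have [k [Fk _]] := FE th th_int.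
by apply: (ex_RInt_ext (fun _ => k)) => [ph _|]; [rewrite Fk | exact: ex_RInt_const].
Qed.

Lemma is_shell_integral_cat F r1 r2 r3 v1 v2 : r1 <= r2 <= r3 ->
  is_shell_integral F r1 r2 v1 -> is_shell_integral F r2 r3 v2 ->
  is_shell_integral F r1 r3 (v1 + v2).
Proof.
move=> r123 [[s1 H1] I1] [[s2 H2] I2]; split; last exact: is_RInt_Chasles I1 I2.
exists (r2 :: s1 ++ s2) => r r13 rs.
have [rr2|rr2|rr2] : [\/ r < r2, r = r2 | r2 < r] by case: (Rtotal_order r r2) => [|[]]; [constructor 1|constructor 2|constructor 3].
- apply: H1; first lra.
  by move=> ?; apply: rs; right; apply/List.in_app_iff; left.
- by case: rs; left.
- apply: H2; first lra.
  by move=> ?; apply: rs; right; apply/List.in_app_iff; right.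
Qed.

Lemma is_shell_integral_of_primitive (F : R -> R -> R -> R) (u du : R -> R) (s : seq R) r1 r2 :
  r1 <= r2 ->
  (forall r, r1 < r < r2 -> ~ List.In r s ->
     angular_integrable F r /\ angular_integral F r = du r) ->
  (forall r, r1 <= r <= r2 -> is_derive u r (du r)) ->
  (forall r, r1 <= r <= r2 -> continuous du r) ->
  is_shell_integral F r1 r2 (u r2 - u r1).
Proof.
move=> r12 FE Du Cdu; split.
  by exists s => r rr rs; case: (FE r rr rs).
apply: (is_RInt_ext_finite (s := s) (f := du)) => //.
  by move=> r rr rs; case: (FE r rr rs).
by apply: (is_RInt_derive u du) => r; rewrite Rmin_left // Rmax_right // => rr; [exact: Du|exact: Cdu].
Qed.

Lemma is_exterior_integral_of_primitive (F : R -> R -> R -> R) (u du : R -> R) (s : seq R) (r1 w : R) :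
  (forall r, r1 < r -> ~ List.In r s ->
     angular_integrable F r /\ angular_integral F r = du r) ->
  (forall r, r1 <= r -> is_derive u r (du r)) ->
  (forall r, r1 <= r -> continuous du r) ->
  is_lim u p_infty w -> is_exterior_integral F r1 (w - u r1).
Proof.
move=> FE Du Cdu Lu; split.
  by exists s => r rr rs; case: (FE r rr rs).
move=> P HP.
have Lv : is_lim (fun r => u r - u r1) p_infty (w - u r1).
  by apply: is_lim_minus' => //; exact: is_lim_const.
have nP : Rbar_locally p_infty (fun r => P (u r - u r1)) by exact: Lv.
have nr : Rbar_locally p_infty (fun r => r1 < r) by exists r1.
apply: (Filter_prod _ _ _ (fun x => x = r1) (fun r => r1 < r /\ P (u r - u r1))).
- by [].
- exact: filter_and.
move=> x y -> [yr Py]; exists (u y - u r1); split => //=.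
have [] // := @is_shell_integral_of_primitive F u du s r1 y.
- lra.
- by move=> r rr; apply: FE; lra.
- by move=> r rr; apply: Du; lra.
- by move=> r rr; apply: Cdu; lra.
Qed.

(** * Piecewise C^2 functions *)

Lemma piecewise_C2_lt f a b : piecewise_C2 f a b -> a < b.
Proof. by elim=> // *; lra. Qed.

(** Needed because m and q may have different breakpoints. *)
Lemma piecewise_C2_restrict f a b : piecewise_C2 f a b ->
  forall c d, a <= c -> c < d -> d <= b -> piecewise_C2 f c d.
Proof.
elim=> [{}a {}b h ab hC2 fh|{}a e {}b _ IH1 _ IH2] c d ac cd db.
  by apply: (piecewise_C2_one cd hC2) => x xcd; apply: fh; lra.
have [de|ed] := Rle_lt_dec d e; first exact: IH1.
have [ec|ce] := Rle_lt_dec e c; first exact: IH2.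
by apply: (piecewise_C2_cat (b := e)); [apply: IH1; lra | apply: IH2; lra].
Qed.

Lemma continuous_eq_right (f g : R -> R) c d : c < d -> continuous f d -> continuous g d ->
  (forall x, c < x < d -> f x = g x) -> f d = g d.
Proof.
move=> cd cf cg fg; apply: NNPP => nfg.
have ch : continuous (fun x => minus (f x) (g x)) d by exact: continuous_minus.
have h0 : minus (f d) (g d) <> 0 by rewrite /minus /plus /opp /=; lra.
have [e He] := ch _ (open_neq 0 _ h0).
(* The midpoint keeps x inside the interval, the other term keeps it within e of d. *)
pose x := Rmax ((c + d) / 2) (d - e / 2).
have ep := cond_pos e.
have xd : c < x < d.
  by split; [apply: Rlt_le_trans (Rmax_l _ _); lra | apply: Rmax_lub_lt; lra].
apply: (He x); last by rewrite fg // /minus /plus /opp /=; ring.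
have := Rmax_r ((c + d) / 2) (d - e / 2); rewrite -/x => xe.
rewrite /ball /= /AbsRing_ball /abs /minus /plus /opp /= Rabs_left; lra.
Qed.

Lemma continuous_eq_left (f g : R -> R) c d : c < d -> continuous f c -> continuous g c ->
  (forall x, c < x < d -> f x = g x) -> f c = g c.
Proof.
move=> cd cf cg fg; have opp (h : R -> R) : continuous h c -> continuous (fun x => h (- x)) (- c).
  move=> ch; apply: (continuous_comp Ropp h); first exact: (continuous_opp (fun x => x) _ (continuous_id _)).
  by rewrite Ropp_involutive.
have := @continuous_eq_right (fun x => f (- x)) (fun x => g (- x)) (- d) (- c).
rewrite Ropp_involutive; apply; [lra|exact: opp|exact: opp|].
by move=> x xcd; apply: fg; lra.
Qed.

(** [Derive] is two-sided, and f and h may differ outside the interval; at the endpoints equality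
    follows from the interior by continuity of both derivatives. *)
Lemma C1_extension (f h : R -> R) a b : a < b -> class_C1 f -> class_C1 h ->
  (forall x, a <= x <= b -> f x = h x) -> forall x, a <= x <= b -> Derive f x = Derive h x.
Proof.
move=> ab [df cf] [dh ch] fh.
have E x : a < x < b -> Derive f x = Derive h x.
  move=> xab; apply: Derive_ext_loc.
  have n1 := open_gt a _ (proj1 xab); have n2 := open_lt b _ (proj2 xab).
  by apply: filter_imp (filter_and _ _ n1 n2) => t [t1 t2]; apply: fh; lra.
move=> x [ax xb].
case: (Rle_lt_or_eq_dec _ _ ax) => [ax'|<-]; last exact: (continuous_eq_left ab).
case: (Rle_lt_or_eq_dec _ _ xb) => [xb'|->]; last exact: (continuous_eq_right ab).
by apply: E.
Qed.

(** * Balance of the fluxes *)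

Section ConservedFlux.

Variable b : background.
Hypotheses (ell_gt0 : 0 < ell b) (Xi_gt0 : 0 < Xi b).

(** At fixed r this is an affine function of sin^2 with the positive value Xi A^2 on the axis, so
    sin^2 takes at most one value at its zeros. *)
Lemma gtt_zeros_finite (D : R -> R) r : 0 < r ->
  exists s : seq R, forall th, 0 < th < PI -> gtt_numerator b D r th = 0 -> List.In th s.
Proof.
move=> r0; pose A := r ^ 2 + spin b ^ 2; pose k := lam b * spin b ^ 2 * A ^ 2 + D r * spin b ^ 2.
have A0 : 0 < Xi b * A ^ 2.
  apply: Rmult_lt_0_compat => //; apply: pow_lt.
  by have := pow2_ge_0 (spin b); have := pow_lt r 2 r0; rewrite /A; lra.
have E th : gtt_numerator b D r th = Xi b * A ^ 2 - k * sin th ^ 2.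
  rewrite /gtt_numerator (Delta_th_lam ell_gt0) (Xi_lam ell_gt0) cos_pow2 /k /A; ring.
have [k0|k0] := Req_dec k 0.
  by exists [::] => th _; rewrite E k0; lra.
have [s sP] := sin_sqr_finite (Xi b * A ^ 2 / k).
exists s => th th_int; rewrite E => e; apply: sP => //.
by apply: (Rmult_eq_reg_l k) => //; field_simplify => //; lra.
Qed.

(** A quartic in r with leading coefficient - lam, which is nonzero. *)
Lemma Delta_r_zeros_finite m0 q0 : exists s : seq R, forall r,
  Delta_r b (fun _ => m0) (fun _ => q0) r = 0 -> List.In r s.
Proof.
pose cs : seq R := [:: spin b ^ 2 + q0 ^ 2; -2 * m0; 1 - lam b * spin b ^ 2; 0; - lam b].
have l0 : - lam b <> 0.
  have e0 := pow_lt _ 2 ell_gt0; apply: Ropp_neq_0_compat; rewrite /lam /Lambda_sign.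
  by apply: Rmult_integral_contrapositive_currified;
    [case: (csign b); lra | apply: Rinv_neq_0_compat; lra].
have p0 : (Poly cs != 0)%R.
  by rewrite -size_poly_eq0 (PolyK (c := 0%R)) //=; apply/eqP.
have [s sP] := finite_roots p0.
exists s => r Dr; apply: sP; apply/rootP; rewrite horner_Poly /=.
rewrite (Delta_r_lam ell_gt0) in Dr; rewrite -[RHS]Dr.
change (((((0 * r + - lam b) * r + 0) * r + (1 - lam b * spin b ^ 2)) * r + -2 * m0) * r
  + (spin b ^ 2 + q0 ^ 2) = (r ^ 2 + spin b ^ 2) * (1 - lam b * r ^ 2) - 2 * m0 * r + q0 ^ 2).
ring.
Qed.

(** The data on which the balance depends, so that K and Y share one argument. [Linf] is the limit
    of the charge at infinity without its factor 2 PI. *)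
Variables (V : 'I_4 -> R) (t0 : R) (Phi : R -> R -> R -> R -> R -> R).
Variables (al al1 de de1 Linf : R -> R).
Hypothesis flux_interpolating : forall (m q : R -> R) (r th ph : R),
  class_C1 m -> class_C1 q -> 0 < r -> 0 < th < PI -> Delta_r b m q r <> 0 ->
  ex_derive (Derive m) r -> ex_derive (Derive q) r ->
  interpolating_flux b V t0 m q r th ph =
  if Req_EM_T (gtt_numerator b (Delta_r b m q) r th) 0 then 0 else
    Phi (mass_profile m q r) (mass_profile1 m q r) (mass_profile2 m q r) r th.
Hypothesis flux_em : forall (m0 q0 r th ph : R),
  0 < r -> 0 < th < PI -> Delta_r b (fun _ => m0) (fun _ => q0) r <> 0 ->
  em_flux b V t0 m0 q0 r th ph =
  if Req_EM_T (gtt_numerator b (Delta_r b (fun _ => m0) (fun _ => q0)) r th) 0 then 0 else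
    Phi (m0 * r - q0 ^ 2 / 2) m0 0 r th.
Hypothesis Phi_integral : forall r f f1 f2, 0 < r ->
  is_RInt (Phi f f1 f2 r) 0 PI (al r * f2 + (al1 r + de r) * f1 + de1 r * f).
Hypothesis dal : forall r, 0 < r -> is_derive al r (al1 r).
Hypothesis dde : forall r, 0 < r -> is_derive de r (de1 r).
Hypothesis cal1 : forall r, 0 < r -> continuous al1 r.
Hypothesis cde1 : forall r, 0 < r -> continuous de1 r.
Hypothesis al_lim : forall m0 q0 : R,
  is_lim (fun r => al r * m0 + de r * (m0 * r - q0 ^ 2 / 2)) p_infty (Linf m0).

(* The integral of U over the sphere of radius [r]. *)
Definition charge (m q : R -> R) (r : R) : R :=
  2 * PI * (al r * mass_profile1 m q r + de r * mass_profile m q r).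
Definition charge1 (m q : R -> R) (r : R) : R :=
  2 * PI * (al r * mass_profile2 m q r + (al1 r + de r) * mass_profile1 m q r
            + de1 r * mass_profile m q r).

Lemma is_derive_charge m q r : 0 < r -> class_C1 m -> class_C1 q ->
  ex_derive (Derive m) r -> ex_derive (Derive q) r ->
  is_derive (charge m q) r (charge1 m q r).
Proof.
move=> r0 cm cq xm xq; have d1 := is_derive_mass_profile r cm cq.
have d2 := is_derive_mass_profile1 cm cq xm xq.
have d3 := dal r0; have d4 := dde r0.
have x1 : ex_derive (mass_profile m q) r by eexists; exact: d1.
have x2 : ex_derive (mass_profile1 m q) r by eexists; exact: d2.
have x3 : ex_derive al r by eexists; exact: d3.
have x4 : ex_derive de r by eexists; exact: d4.
rewrite /charge /charge1; auto_derive; first by nonzero.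
rewrite (is_derive_unique _ _ _ d1) (is_derive_unique _ _ _ d2).
rewrite (is_derive_unique _ _ _ d3) (is_derive_unique _ _ _ d4); ring.
Qed.

Lemma continuous_charge1 m q r : 0 < r -> class_C2 m -> class_C2 q ->
  continuous (charge1 m q) r.
Proof.
move=> r0 [cm [dm2 cm2]] [cq [dq2 cq2]].
have ex_cont (h : R -> R) d : is_derive h r d -> continuous h r.
  by move=> ?; apply: ex_derive_continuous; exists d.
have c1 := ex_cont _ _ (is_derive_mass_profile r cm cq).
have c2 := ex_cont _ _ (is_derive_mass_profile1 cm cq (dm2 r) (dq2 r)).
have c3 := ex_cont _ _ (dal r0); have c4 := ex_cont _ _ (dde r0).
have cm0 : continuous m r by apply: ex_derive_continuous; exact: (proj1 cm).
have cq0 : continuous q r by apply: ex_derive_continuous; exact: (proj1 cq).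
have mult (g h : R -> R) : continuous g r -> continuous h r -> continuous (fun x => g x * h x) r.
  by move=> *; apply: (continuous_mult (K := R_AbsRing) g h).
have add (g h : R -> R) : continuous g r -> continuous h r -> continuous (fun x => g x + h x) r.
  by move=> *; apply: (continuous_plus (V := R_NormedModule) g h).
have sub (g h : R -> R) : continuous g r -> continuous h r -> continuous (fun x => g x - h x) r.
  by move=> *; apply: (continuous_minus (V := R_NormedModule) g h).
have c5 : continuous (mass_profile2 m q) r.
  have E x : Derive (Derive m) x * x + 2 * Derive m x - Derive q x * Derive q x
      - q x * Derive (Derive q) x = mass_profile2 m q x by rewrite /mass_profile2; ring.
  apply: (continuous_ext _ _ _ E).
  apply: (sub); [apply: (sub); [apply: (add); apply: (mult)|apply: (mult)]|apply: (mult)] => //;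
  try exact: continuous_id; try exact: continuous_const; by [exact: (proj2 cm)|exact: (proj2 cq)].
apply: (mult); first exact: continuous_const.
apply: (add); [apply: (add); apply: (mult)|apply: (mult)] => //; [apply: (add) => //; exact: cal1|exact: cde1].
Qed.

Lemma angular_flux m q r : class_C1 m -> class_C1 q -> 0 < r -> Delta_r b m q r <> 0 ->
  ex_derive (Derive m) r -> ex_derive (Derive q) r ->
  angular_integrable (interpolating_flux b V t0 m q) r /\
  angular_integral (interpolating_flux b V t0 m q) r = charge1 m q r.
Proof.
move=> cm cq r0 D0 xm xq; have [s sP] := gtt_zeros_finite (Delta_r b m q) r0.
apply: (angular_integral_E (s := s) (Ph := Phi (mass_profile m q r) (mass_profile1 m q r)
  (mass_profile2 m q r) r)); last exact: Phi_integral.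
move=> th th_int; eexists; split.
  by move=> ph; rewrite flux_interpolating.
by case: Req_EM_T => //= h hs; case: hs; exact: sP.
Qed.

Lemma angular_em_flux m0 q0 r : 0 < r -> Delta_r b (fun _ => m0) (fun _ => q0) r <> 0 ->
  angular_integrable (em_flux b V t0 m0 q0) r /\
  angular_integral (em_flux b V t0 m0 q0) r = charge1 (fun _ => m0) (fun _ => q0) r.
Proof.
move=> r0 D0; have [s sP] := gtt_zeros_finite (Delta_r b (fun _ => m0) (fun _ => q0)) r0.
have -> : charge1 (fun _ => m0) (fun _ => q0) r =
    2 * PI * (al r * 0 + (al1 r + de r) * m0 + de1 r * (m0 * r - q0 ^ 2 / 2)).
  rewrite /charge1 /mass_profile2 /mass_profile1 /mass_profile.
  rewrite !(Derive_ext (Derive (fun _ => _)) (fun _ => 0)); try (by move=> t; rewrite Derive_const).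
  by rewrite !Derive_const; ring.
apply: (angular_integral_E (s := s) (Ph := Phi (m0 * r - q0 ^ 2 / 2) m0 0 r));
  last exact: Phi_integral.
move=> th th_int; eexists; split.
  by move=> ph; rewrite flux_em.
by case: Req_EM_T => //= h hs; case: hs; exact: sP.
Qed.

Lemma class_C2_const k : class_C2 (fun _ => k).
Proof.
have D0 : forall x, Derive (fun _ => k) x = 0 by move=> x; rewrite Derive_const.
have D00 : forall x, Derive (Derive (fun _ => k)) x = 0.
  by move=> x; rewrite (Derive_ext _ (fun _ => 0)) // Derive_const.
split; split=> x.
- exact: ex_derive_const.
- by apply: (continuous_ext (fun _ => 0)) => [t|]; [rewrite D0 | exact: continuous_const].
- by apply: (ex_derive_ext (fun _ => 0)) => [t|]; [rewrite D0 | exact: ex_derive_const].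
- by apply: (continuous_ext (fun _ => 0)) => [t|]; [rewrite D00 | exact: continuous_const].
Qed.

(** The charge is a primitive on all of r > 0, horizons included, and the zeros of Delta_r are among
    the exempted radii. *)
Lemma exterior_em_flux m0 q0 r1 : 0 < r1 ->
  is_exterior_integral (em_flux b V t0 m0 q0) r1
    (2 * PI * Linf m0 - charge (fun _ => m0) (fun _ => q0) r1).
Proof.
move=> r1_gt0; have [s sP] := Delta_r_zeros_finite m0 q0.
have [cm cm'] := class_C2_const m0; have [cq cq'] := class_C2_const q0.
apply: (is_exterior_integral_of_primitive (s := s)
  (du := charge1 (fun _ => m0) (fun _ => q0))).
- move=> r rr rs; apply: angular_em_flux; first lra.
  by move=> D0; apply: rs; exact: sP.
- by move=> r rr; apply: is_derive_charge => //; [lra|exact: (proj1 cm')|exact: (proj1 cq')].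
- by move=> r rr; apply: continuous_charge1; [lra|..]; exact: class_C2_const.
- apply: (is_lim_ext (fun r => 2 * PI * (al r * m0 + de r * (m0 * r - q0 ^ 2 / 2)))).
    by move=> r; rewrite /charge /mass_profile1 /mass_profile !Derive_const; ring.
  by apply: (is_lim_scal_l _ (2 * PI) p_infty (Linf m0)); exact: al_lim.
Qed.

Lemma shell_flux_C2 m q r1 r2 : 0 < r1 -> r1 <= r2 -> class_C2 m -> class_C2 q ->
  (forall r, r1 <= r <= r2 -> 0 < Delta_r b m q r) ->
  is_shell_integral (interpolating_flux b V t0 m q) r1 r2 (charge m q r2 - charge m q r1).
Proof.
move=> r10 r12 cm cq D0; have [cm1 [dm2 _]] := cm; have [cq1 [dq2 _]] := cq.
apply: (is_shell_integral_of_primitive (s := [::]) (du := charge1 m q)) => //.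
- move=> r rr _; apply: angular_flux => //; first lra.
  by apply: Rgt_not_eq; apply: D0; lra.
- by move=> r rr; apply: is_derive_charge => //; lra.
- by move=> r rr; apply: continuous_charge1 => //; lra.
Qed.

(** The charge involves values and first derivatives only, so by [C1_extension] the charges of (m,
    q) and (hm, hq) agree up to and including the endpoints. *)
Lemma shell_flux_piece m q hm hq r1 r2 : 0 < r1 -> r1 < r2 -> class_C1 m -> class_C1 q ->
  class_C2 hm -> class_C2 hq -> (forall r, r1 <= r <= r2 -> m r = hm r) ->
  (forall r, r1 <= r <= r2 -> q r = hq r) ->
  (forall r, r1 <= r <= r2 -> 0 < Delta_r b m q r) ->
  is_shell_integral (interpolating_flux b V t0 m q) r1 r2 (charge m q r2 - charge m q r1).
Proof.
move=> r10 r12 cm cq chm chq mE qE D0.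
have [[chm1 chm2] [chq1 chq2]] := (chm, chq).
have m1E := C1_extension r12 cm chm1 mE; have q1E := C1_extension r12 cq chq1 qE.
have uE r : r1 <= r <= r2 -> charge m q r = charge hm hq r.
  move=> rr; rewrite /charge /mass_profile1 /mass_profile.
  by rewrite (mE _ rr) (qE _ rr) (m1E _ rr) (q1E _ rr).
have near r (P : R -> Prop) : r1 < r < r2 -> (forall t, r1 <= t <= r2 -> P t) -> locally r P.
  move=> [lr ru] HP; have n1 := open_gt r1 _ lr; have n2 := open_lt r2 _ ru.
  by apply: filter_imp (filter_and _ _ n1 n2) => t [t1 t2]; apply: HP; lra.
rewrite !uE; try lra.
apply: (is_shell_integral_of_primitive (s := [::]) (du := charge1 hm hq)) => //.
- lra.
- move=> r rr _.
  have nm : locally r (fun t => Derive hm t = Derive m t).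
    by apply: near => // t /m1E.
  have nq : locally r (fun t => Derive hq t = Derive q t).
    by apply: near => // t /q1E.
  have -> : charge1 hm hq r = charge1 m q r.
    rewrite /charge1 /mass_profile2 /mass_profile1 /mass_profile.
    rewrite (Derive_ext_loc _ _ _ nm) (Derive_ext_loc _ _ _ nq).
    by rewrite mE ?qE ?m1E ?q1E //; lra.
  apply: angular_flux => //; first lra.
  + by apply: Rgt_not_eq; apply: D0; lra.
  + by apply: (ex_derive_ext_loc _ _ _ nm); exact: (proj1 chm2).
  + by apply: (ex_derive_ext_loc _ _ _ nq); exact: (proj1 chq2).
- by move=> r rr; apply: is_derive_charge => //; [lra|exact: (proj1 chm2)|exact: (proj1 chq2)].
- by move=> r rr; apply: continuous_charge1 => //; lra.
Qed.

(** Induction on the pieces of m, with q restricted accordingly, then on the pieces of q inside one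
    piece of m. Charges at inner breakpoints telescope. *)
Lemma shell_flux_piecewise m q r1 r2 : 0 < r1 -> class_C1 m -> class_C1 q ->
  (forall r, r1 <= r <= r2 -> 0 < Delta_r b m q r) ->
  piecewise_C2 m r1 r2 -> piecewise_C2 q r1 r2 ->
  is_shell_integral (interpolating_flux b V t0 m q) r1 r2 (charge m q r2 - charge m q r1).
Proof.
move=> r10 cm cq D0 pm pq.
have cat c d e : c <= d <= e ->
    is_shell_integral (interpolating_flux b V t0 m q) c d (charge m q d - charge m q c) ->
    is_shell_integral (interpolating_flux b V t0 m q) d e (charge m q e - charge m q d) ->
    is_shell_integral (interpolating_flux b V t0 m q) c e (charge m q e - charge m q c).
  move=> cde H1 H2; have := is_shell_integral_cat cde H1 H2.
  by congr is_shell_integral; ring.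
elim: {r1 r2} pm r10 D0 pq => [r1 r2 hm r12 chm mE|r1 e r2 pm1 IH1 pm2 IH2] r10 D0 pq; last first.
  have lt1 := piecewise_C2_lt pm1; have lt2 := piecewise_C2_lt pm2.
  apply: (cat r1 e r2); first lra.
    apply: IH1 => //; first by move=> r rr; apply: D0; lra.
    by apply: piecewise_C2_restrict pq _ _ _ _ _; lra.
  apply: IH2 => //; first lra.
    by move=> r rr; apply: D0; lra.
  by apply: piecewise_C2_restrict pq _ _ _ _ _; lra.
elim: {r1 r2 r12} pq r10 D0 mE => [r1 r2 hq r12 chq qE|r1 e r2 pq1 IH1 pq2 IH2] r10 D0 mE.
  exact: (shell_flux_piece r10 r12 cm cq chm chq).
have lt1 := piecewise_C2_lt pq1; have lt2 := piecewise_C2_lt pq2.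
apply: (cat r1 e r2); first lra.
  by apply: IH1 => // r rr; [apply: D0|apply: mE]; lra.
by apply: IH2; [lra|move=> r rr; apply: D0; lra|move=> r rr; apply: mE; lra].
Qed.

Lemma Delta_r_approximation_gt0 (m q : R -> R) (mn qn : nat -> R -> R) r1 r2 :
  0 < r1 -> r1 <= r2 -> class_C1 m -> class_C1 q ->
  (forall r, r1 <= r <= r2 -> 0 < Delta_r b m q r) ->
  C2_approximation mn m r1 r2 -> C2_approximation qn q r1 r2 ->
  eventually (fun n => forall r, r1 <= r <= r2 -> 0 < Delta_r b (mn n) (qn n) r).
Proof.
move=> r10 r12 cm cq D0 [_ mn_lim] [_ qn_lim].
have cD r : r1 <= r <= r2 -> continuity_pt (Delta_r b m q) r.
  move=> _; apply/continuity_pt_filterlim; apply: ex_derive_continuous.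
  by eexists; exact: is_derive_Delta_r.
have cq0 r : r1 <= r <= r2 -> continuity_pt (fun r => Rabs (q r)) r.
  move=> _; apply: (continuity_pt_comp q Rabs); last exact: Rcontinuity_abs.
  by apply/continuity_pt_filterlim; apply: ex_derive_continuous; exact: (proj1 cq).
have [rm [Hm rm_int]] := continuity_ab_min _ _ _ r12 cD.
have [rM [HM rM_int]] := continuity_ab_maj _ _ _ r12 cq0.
set M := Rabs (q rM) in HM; set d := Delta_r b m q rm in Hm.
have d0 : 0 < d by exact: D0.
have M0 : 0 <= M by exact: Rabs_pos.
(* If m and q change by less than e <= 1, then Delta_r drops by at most e (2 r2 + 2 M + 1), where M
   bounds |q|. The constant 2 in place of 1 makes this strictly less than the minimum d. *)
pose e := Rmin 1 (d / (2 * r2 + 2 * M + 2)).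
have k0 : 0 < 2 * r2 + 2 * M + 2 by lra.
have e0 : 0 < e by apply: Rmin_glb_lt; [lra | exact: Rdiv_lt_0_compat].
have e1 : e <= 1 by exact: Rmin_l.
have ek : e * (2 * r2 + 2 * M + 2) <= d.
  have := Rmult_le_compat_r _ _ _ (Rlt_le _ _ k0) (Rmin_r 1 (d / (2 * r2 + 2 * M + 2))).
  by rewrite -/e; have -> : d / (2 * r2 + 2 * M + 2) * (2 * r2 + 2 * M + 2) = d by field; lra.
have [n1 H1] := mn_lim e e0; have [n2 H2] := qn_lim e e0.
exists (maxn n1 n2) => n /leP; rewrite geq_max => /andP [/leP le1 /leP le2] r rr.
have [mE _] := H1 n (introT leP le1) r rr; have [qE _] := H2 n (introT leP le2) r rr.
have Dm := Hm r rr; have qM := HM r rr.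
rewrite (Delta_r_lam ell_gt0) in Dm; rewrite (Delta_r_lam ell_gt0).
move: Dm mE qE qM; move: (_ * (1 - _)) (mn n r) (qn n r) (m r) (q r) => B u v u0 v0 Dm uE vE vM.
have [uE1 uE2] := Rabs_def2 _ _ uE; have [vE1 vE2] := Rabs_def2 _ _ vE.
have [vM1 vM2] : - M <= v0 <= M by apply/Rabs_le_between.
have h1 : 2 * u * r <= 2 * u0 * r + 2 * e * r2 by nra.
have h2 : v ^ 2 >= v0 ^ 2 - (2 * M + 1) * e by nra.
have : 2 * e * r2 + (2 * M + 1) * e < d by nra.
lra.
Qed.

(** Convergence of m, m', q, q' at the single radius r is enough. *)
Lemma is_lim_seq_charge (m q : R -> R) (mn qn : nat -> R -> R) r1 r2 r :
  C2_approximation mn m r1 r2 -> C2_approximation qn q r1 r2 -> r1 <= r <= r2 ->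
  is_lim_seq (fun n => charge (mn n) (qn n) r) (charge m q r).
Proof.
move=> [_ mn_lim] [_ qn_lim] rr.
have L (h : nat -> R) (k : R) :
    (forall e, 0 < e -> exists n0 : nat, forall n : nat, (n0 <= n)%N -> Rabs (h n - k) < e) ->
    is_lim_seq h k.
  move=> H; apply/is_lim_seq_Reals => e e0; have [n0 Hn] := H e e0.
  by exists n0 => n /leP; exact: Hn.
have Lm : is_lim_seq (fun n => mn n r) (m r).
  by apply: L => e /mn_lim [n0 H]; exists n0 => n /H /(_ r rr) [].
have Lm1 : is_lim_seq (fun n => Derive (mn n) r) (Derive m r).
  by apply: L => e /mn_lim [n0 H]; exists n0 => n /H /(_ r rr) [].
have Lq : is_lim_seq (fun n => qn n r) (q r).
  by apply: L => e /qn_lim [n0 H]; exists n0 => n /H /(_ r rr) [].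
have Lq1 : is_lim_seq (fun n => Derive (qn n) r) (Derive q r).
  by apply: L => e /qn_lim [n0 H]; exists n0 => n /H /(_ r rr) [].
have E mm mm1 qq qq1 : 2 * PI * (al r * (mm1 * r + mm - qq * qq1) + de r * (mm * r - qq * qq * / 2))
  = 2 * PI * (al r * (mm1 * r + mm - qq * qq1) + de r * (mm * r - qq ^ 2 / 2)) by field.
rewrite /charge /mass_profile1 /mass_profile -E.
apply: (is_lim_seq_ext (fun n => 2 * PI * (al r * (Derive (mn n) r * r + mn n r - qn n r *
  Derive (qn n) r) + de r * (mn n r * r - qn n r * qn n r * / 2)))); first by move=> n; exact: E.
repeat first [ exact: Lm | exact: Lm1 | exact: Lq | exact: Lq1 | apply: is_lim_seq_const
  | apply: is_lim_seq_minus' | apply: is_lim_seq_plus' | apply: is_lim_seq_mult' ].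
Qed.

Lemma profile_flux m q r1 r2 : 0 < r1 -> r1 <= r2 -> class_C1 m -> class_C1 q ->
  (forall r, r1 <= r <= r2 -> 0 < Delta_r b m q r) ->
  is_profile_integral (interpolating_flux b V t0) m q r1 r2 (charge m q r2 - charge m q r1).
Proof.
move=> r10 r12 cm cq D0; split; first exact: shell_flux_piecewise.
move=> mn qn amn aqn.
exists (fun n => charge (mn n) (qn n) r2 - charge (mn n) (qn n) r1); split.
  have := Delta_r_approximation_gt0 r10 r12 cm cq D0 amn aqn.
  apply: filter_imp => n Dn; apply: shell_flux_C2 => //; [exact: (proj1 amn)|exact: (proj1 aqn)].
by apply: is_lim_seq_minus'; apply: is_lim_seq_charge; [exact: amn|exact: aqn|lra|exact: amn|exact: aqn|lra].
Qed.

Lemma flux_balance m q m1 m2 q1 q2 r1 r2 : 0 < r1 -> r1 < r2 -> class_C1 m -> class_C1 q ->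
  (forall r, r1 <= r <= r2 -> 0 < Delta_r b m q r) ->
  m r1 = m1 -> m r2 = m2 -> q r1 = q1 -> q r2 = q2 ->
  Derive m r1 = 0 -> Derive m r2 = 0 -> Derive q r1 = 0 -> Derive q r2 = 0 ->
  exists E_S E_2 E_1 : R,
    [/\ is_profile_integral (interpolating_flux b V t0) m q r1 r2 E_S,
        is_exterior_integral (em_flux b V t0 m2 q2) r2 E_2,
        is_exterior_integral (em_flux b V t0 m1 q1) r1 E_1
      & E_S + E_2 - E_1 = 2 * PI * (Linf m2 - Linf m1)].
Proof.
move=> r10 r12 cm cq D0 m1E m2E q1E q2E dm1 dm2 dq1 dq2.
exists (charge m q r2 - charge m q r1).
exists (2 * PI * Linf m2 - charge (fun _ => m2) (fun _ => q2) r2).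
exists (2 * PI * Linf m1 - charge (fun _ => m1) (fun _ => q1) r1).
split.
- by apply: profile_flux => //; lra.
- by apply: exterior_em_flux; lra.
- exact: exterior_em_flux.
rewrite /charge /mass_profile1 /mass_profile !Derive_const dm1 dm2 dq1 dq2 m1E m2E q1E q2E.
ring.
Qed.

End ConservedFlux.

(** The derivative vanishes on the open side where f is constant, hence at the endpoint by
    continuity. *)
Lemma Derive_locally_constant_left (f : R -> R) (r0 k : R) :
  (forall r, r <= r0 -> f r = k) -> continuous (Derive f) r0 -> Derive f r0 = 0.
Proof.
move=> fk cf; have r01 : r0 - 1 < r0 by lra.
apply: (continuous_eq_right r01 cf (continuous_const 0 r0)) => x xr.
rewrite -(Derive_const k x); apply: Derive_ext_loc.
have n := open_lt r0 _ (proj2 xr).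
by apply: filter_imp n => t tr; apply: fk; lra.
Qed.

Lemma Derive_locally_constant_right (f : R -> R) (r0 k : R) :
  (forall r, r0 <= r -> f r = k) -> continuous (Derive f) r0 -> Derive f r0 = 0.
Proof.
move=> fk cf; have r01 : r0 < r0 + 1 by lra.
apply: (continuous_eq_left r01 cf (continuous_const 0 r0)) => x xr.
rewrite -(Derive_const k x); apply: Derive_ext_loc.
have n := open_gt r0 _ (proj1 xr).
by apply: filter_imp n => t tr; apply: fk; lra.
Qed.

Theorem mainTheorem3 (b : background) (m q : R -> R)
    (m1 m2 q1 q2 r1 r2 t0 : R)
    (ell_gt0 : 0 < ell b)
    (Xi_gt0 : 0 < Xi b)
    (m12 : m1 < m2)
    (r12 : r1 < r2)
    (m_inner : forall r, r <= r1 -> m r = m1)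
    (m_outer : forall r, r2 <= r -> m r = m2)
    (q_inner : forall r, r <= r1 -> q r = q1)
    (q_outer : forall r, r2 <= r -> q r = q2)
    (m_C1 : class_C1 m)
    (q_C1 : class_C1 q)
    (dq_r1 : Derive q r1 = 0)
    (dq_r2 : Derive q r2 = 0)
    (r1_horizon : exists rh, is_event_horizon b m1 q1 rh /\ rh < r1)
    (r2_horizon : csign b = DeSitter ->
       exists rc, is_cosmological_horizon b m2 q2 rc /\ r2 < rc)
    (Delta_gt0 : forall r, r1 <= r <= r2 -> 0 < Delta_r b m q r)
    (S_spacelike : forall r th ph, r1 <= r <= r2 -> 0 < th < PI ->
       spacelike_at (kn_metric b m q) (bl_point t0 r th ph)) :
  (exists E_S E_2 E_1 : R,
     is_profile_integral (interpolating_flux b (Kvec b) t0) m q r1 r2 E_S /\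
     is_exterior_integral (em_flux b (Kvec b) t0 m2 q2) r2 E_2 /\
     is_exterior_integral (em_flux b (Kvec b) t0 m1 q1) r1 E_1 /\
     E_S + E_2 - E_1 = phys_mass b m2 - phys_mass b m1) /\
  (exists L_S L_2 L_1 : R,
     is_profile_integral (interpolating_flux b Yvec t0) m q r1 r2 L_S /\
     is_exterior_integral (em_flux b Yvec t0 m2 q2) r2 L_2 /\
     is_exterior_integral (em_flux b Yvec t0 m1 q1) r1 L_1 /\
     - L_S - L_2 + L_1 = phys_angmom b m2 - phys_angmom b m1).
Proof.
(* Horizon radii are positive by definition, which places the whole region in r > 0, where rho2 >
   0. *)
have r1_gt0 : 0 < r1 by have [rh [[rh0 _ _] rh1]] := r1_horizon; lra.
have dm1 : Derive m r1 = 0.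
  exact: (Derive_locally_constant_left m_inner (proj2 m_C1 r1)).
have dm2 : Derive m r2 = 0.
  exact: (Derive_locally_constant_right m_outer (proj2 m_C1 r2)).
have X0 : Xi b <> 0 by lra.
have PI0 := PI_neq0.
have mr1 := m_inner _ (Rle_refl r1); have mr2 := m_outer _ (Rle_refl r2).
have qr1 := q_inner _ (Rle_refl r1); have qr2 := q_outer _ (Rle_refl r2).
split.
- have [||||||||E_S [E_2 [E_1 [HS H2 H1 E]]]] := @flux_balance b ell_gt0 Xi_gt0 (Kvec b) t0
    (Phi_K b) (al_K b) (al1_K b) (de_K b) (de1_K b) (fun k => 8 * / (16 * PI * Xi b ^ 2) * k)
    _ _ _ _ _ _ _ _ m q m1 m2 q1 q2 r1 r2 r1_gt0 r12 m_C1 q_C1 Delta_gt0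
    mr1 mr2 qr1 qr2 dm1 dm2 dq_r1 dq_r2.
  + by move=> *; apply: interpolating_flux_E => //; left.
  + by move=> *; apply: em_flux_E => //; left.
  + by move=> *; apply: is_RInt_Phi_K.
  + by move=> *; apply: is_derive_al_K.
  + by move=> *; apply: is_derive_de_K.
  + by move=> *; apply: continuous_al1_K.
  + by move=> *; apply: continuous_de1_K.
  + by move=> *; apply: is_lim_K.
  exists E_S, E_2, E_1; do !split => //.
  by rewrite E /phys_mass; field.
- have [||||||||L_S [L_2 [L_1 [HS H2 H1 E]]]] := @flux_balance b ell_gt0 Xi_gt0 Yvec t0
    (Phi_Y b) (al_Y b) (al1_Y b) (de_Y b) (de1_Y b)
    (fun k => - (8 * / (16 * PI * Xi b ^ 2) * spin b * k))
    _ _ _ _ _ _ _ _ m q m1 m2 q1 q2 r1 r2 r1_gt0 r12 m_C1 q_C1 Delta_gt0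
    mr1 mr2 qr1 qr2 dm1 dm2 dq_r1 dq_r2.
  + by move=> *; apply: interpolating_flux_E => //; right.
  + by move=> *; apply: em_flux_E => //; right.
  + by move=> *; apply: is_RInt_Phi_Y.
  + by move=> *; apply: is_derive_al_Y.
  + by move=> *; apply: is_derive_de_Y.
  + by move=> *; apply: continuous_al1_Y.
  + by move=> *; apply: continuous_de1_Y.
  + by move=> *; apply: is_lim_Y.
  exists L_S, L_2, L_1; do !split => //.
  have -> : - L_S - L_2 + L_1 = - (L_S + L_2 - L_1) by ring.
  by rewrite E /phys_angmom; field.
Qed.
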